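(* Let $n \ge 1$ be an integer, let $\mathrm{Free}_n$ be the free group on $n$ generators, and let $\mathcal{A} = \mathbb{C}[\mathrm{Free}_n] = \mathbb{C}\langle X_1^{\pm 1}, \dots, X_n^{\pm 1}\rangle$ be its group ring over $\mathbb{C}$. For every $a \in \mathcal{A}$, the formal power series $$P_a(t) := \exp\left(-\sum_{k \ge 1} \frac{\mathrm{Tr}(a^k)}{k}\, t^k\right) \in \mathbb{C}[[t]],$$ where $\mathrm{Tr}(b) \in \mathbb{C}$ denotes the coefficient of the identity element of $\mathrm{Free}_n$ in $b \in \mathcal{A}$, is algebraic, i.e. it is algebraic over the field $\mathbb{C}(t)$ of rational functions.
   Context: Elements of the group ring $\mathbb{C}[\mathrm{Free}_n]$ are finite formal sums $\sum_{g \in \mathrm{Free}_n} c_g \cdot g$ with $c_g \in \mathbb{C}$, and $c_g = 0$ for all but finitely many $g$. The linear functional $\mathrm{Tr} : \mathbb{C}[\mathrm{Free}_n] \to \mathbb{C}$ is the constant term, $\sum_g c_g \cdot g \mapsto c_{\mathrm{id}}$. Powers $a^k$ are taken in the group ring, and $\exp$ is the exponential of a formal power series with zero constant term. A series $P \in \mathbb{C}[[t]]$ is called algebraic if $P \in \overline{\mathbb{C}(t)} \cap \mathbb{C}[[t]]$ inside $\overline{\mathbb{C}((t))}$, i.e. there is a nonzero polynomial $Q(t, z) \in \mathbb{C}[t, z]$ with $Q(t, P(t)) = 0$ in $\mathbb{C}[[t]]$. *)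

(* Defs.v *)
From HB Require Import structures.
From mathcomp Require Import all_boot all_order all_algebra.
From mathcomp Require Import finmap boolp reals complex.
From mathcomp.multinomials Require Import monalg.

Set Implicit Arguments.
Unset Strict Implicit.
Unset Printing Implicit Defensive.

Import GRing.Theory.

Section FreeGroup.

Variable n : nat.

(* The letter (i, false) stands for X_i and (i, true) for X_i^-1. *)
Definition letter : Type := 'I_n * bool.

Definition letter_inv (x : letter) : letter := (x.1, ~~ x.2).

Definition reduced (w : seq letter) : bool :=
  sorted (fun x y => y != letter_inv x) w.

Record free_group : predArgType := FreeGroup {
  word_of :> seq letter;
  word_of_reduced : reduced word_of
}.

HB.instance Definition _ := [isSub for word_of].
HB.instance Definition _ := [Choice of free_group by <:].

Definition cons_red (x : letter) (w : seq letter) : seq letter :=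
  if w is y :: w' then if y == letter_inv x then w' else x :: w else [:: x].

Definition word_mul (u v : seq letter) : seq letter := foldr cons_red v u.

Definition word_inv (u : seq letter) : seq letter := rev (map letter_inv u).

Lemma letter_invK : involutive letter_inv.
Proof. by case=> i b; rewrite /letter_inv /= negbK. Qed.

Lemma reduced_behead x w : reduced (x :: w) -> reduced w.
Proof. exact: path_sorted. Qed.

Lemma cons_red_reduced x w : reduced w -> reduced (cons_red x w).
Proof.
case: w => // y w rw /=; case: eqP => [_|/eqP ne]; first exact: reduced_behead rw.
by rewrite /reduced /= ne.
Qed.

Lemma cons_redK x w : reduced w -> cons_red x (cons_red (letter_inv x) w) = w.
Proof.
case: w => [|y w] /=; first by rewrite eqxx.
rewrite letter_invK; case: eqP => [->|_ _]; last by rewrite /= eqxx.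
by case: w => //= z w /andP[/negbTE -> _].
Qed.

Lemma word_mul_reduced u v : reduced v -> reduced (word_mul u v).
Proof. by move=> rv; elim: u => //= x u; apply: cons_red_reduced. Qed.

Lemma word_mulA u v w : reduced v -> reduced w ->
  word_mul u (word_mul v w) = word_mul (word_mul u v) w.
Proof.
move=> rv rw; elim: u => //= x u ->.
have: reduced (word_mul u v) by apply: word_mul_reduced.
case: (word_mul u v) => //= y s _; case: eqP => // ->.
by rewrite cons_redK // word_mul_reduced.
Qed.

Lemma word_mulu0 u : reduced u -> word_mul u [::] = u.
Proof.
elim: u => //= x u IHu ru; rewrite IHu ?(reduced_behead ru) //.
by case: u ru {IHu} => //= y u /andP[/negbTE ->].
Qed.

Lemma word_inv_reduced u : reduced u -> reduced (word_inv u).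
Proof.
move=> ru; rewrite /reduced /word_inv rev_sorted sorted_map.
apply: sub_sorted ru => x y /=; apply: contra_neq => ->.
by rewrite letter_invK.
Qed.

Lemma word_invK u : word_inv (word_inv u) = u.
Proof.
by rewrite /word_inv map_rev revK -map_comp map_id_in // => x _; rewrite /= letter_invK.
Qed.

Lemma word_mulVu u : word_mul (word_inv u) u = [::].
Proof.
elim: u => //= x u IHu.
rewrite /word_inv /= rev_cons /word_mul foldr_rcons /= letter_invK eqxx.
exact: IHu.
Qed.

Definition fg_one := @FreeGroup [::] isT.
Definition fg_mul (u v : free_group) :=
  FreeGroup (word_mul_reduced u (word_of_reduced v)).
Definition fg_inv (u : free_group) :=
  FreeGroup (word_inv_reduced (word_of_reduced u)).

Fact fg_mulA : associative fg_mul.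
Proof. by move=> u v w; apply/val_inj/word_mulA; apply: word_of_reduced. Qed.

Fact fg_mul1 : left_id fg_one fg_mul.
Proof. by move=> u; apply/val_inj. Qed.

Fact fg_mulr1 : right_id fg_one fg_mul.
Proof. by move=> u; apply/val_inj/word_mulu0/word_of_reduced. Qed.

Fact fg_mulV : left_inverse fg_one fg_inv fg_mul.
Proof. by move=> u; apply/val_inj/word_mulVu. Qed.

Fact fg_mulrV : right_inverse fg_one fg_inv fg_mul.
Proof.
by move=> u; apply/val_inj; rewrite /= -{1}[word_of u]word_invK word_mulVu.
Qed.

HB.instance Definition _ :=
  isGroup.Build free_group fg_mulA fg_mul1 fg_mulr1 fg_mulV fg_mulrV.

Definition fg_gen (i : 'I_n) : free_group := @FreeGroup [:: (i, false)] isT.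

End FreeGroup.

Section FreeGroupUniversal.

Variables (n : nat) (G : groupType) (f : 'I_n -> G).

Definition letter_eval (x : letter n) : G :=
  (if x.2 then (f x.1)^-1 else f x.1)%g.

Definition fg_lift (u : free_group n) : G :=
  (\big[*%g/1]_(x <- word_of u) letter_eval x)%g.

Lemma fg_lift_gen i : fg_lift (fg_gen i) = f i.
Proof. by rewrite /fg_lift big_seq1. Qed.

Lemma fg_liftM : {morph fg_lift : u v / (u * v)%g}.
Proof.
move=> u v; rewrite /fg_lift /=.
elim: (word_of u) => [|x w IHw] /=; first by rewrite big_nil mul1g.
rewrite big_cons -mulgA -IHw; case: (word_mul w v) => [|y s] /=.
  by rewrite big_seq1 big_nil mulg1.
case: eqP => [->|_]; last by rewrite !big_cons.
rewrite big_cons /letter_eval /=.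
by case: x.2 => /=; rewrite ?mulKg ?mulVKg.
Qed.

Lemma fg_lift_uniq (h : free_group n -> G) :
  {morph h : u v / (u * v)%g} -> (forall i, h (fg_gen i) = f i) -> h =1 fg_lift.
Proof.
move=> hM hf.
have h1 : h 1%g = 1%g by apply: (mulgI (h 1%g)); rewrite -hM !mulg1.
have hV u : h (u^-1)%g = ((h u)^-1)%g.
  by apply: (mulgI (h u)); rewrite -hM !mulgV.
have hl x : h (@FreeGroup n [:: x] isT) = letter_eval x.
  case: x => i []; rewrite /letter_eval /= -hf // -hV.
  by congr h; apply: val_inj.
case=> w rw; rewrite /fg_lift /=.
elim: w rw => [|x w IHw] rw.
  by rewrite big_nil -h1; congr h; apply: val_inj.
rewrite big_cons -(IHw (reduced_behead rw)) -hl -hM; congr h.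
apply: val_inj => /=; case: w rw {IHw} => //= y w /andP[/negbTE -> _].
by [].
Qed.

End FreeGroupUniversal.

Local Open Scope ring_scope.

(* {malg R[G]} already carries a ring structure when G is a monomType, which
   excludes groups; hence the alias. *)
Definition group_ring (R : nzRingType) (G : groupType) : Type := {malg R[G]}.

Section GroupRing.

Variables (R : nzRingType) (G : groupType).

HB.instance Definition _ := GRing.Lmodule.copy (group_ring R G) {malg R[G]}.

Implicit Types a b c : group_ring R G.

Definition gr_elt (r : R) (x : G) : group_ring R G := << r *g x >>.

Definition gr_one : group_ring R G := gr_elt 1 1%g.

Definition gr_mul a b : group_ring R G :=
  \sum_(x <- msupp a) \sum_(y <- msupp b) gr_elt (a@_x * b@_y) (x * y)%g.

Definition gr_trace a : R := a@_(1%g : G).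

Lemma gr_elt0 x : gr_elt 0 x = 0.
Proof. exact: monalgU0. Qed.

Lemma gr_eltD r s x : gr_elt (r + s) x = gr_elt r x + gr_elt s x.
Proof. exact: monalgUD. Qed.

Lemma gr_mulw (d1 d2 : {fset G}) a b :
    (msupp a `<=` d1)%fset -> (msupp b `<=` d2)%fset ->
  gr_mul a b = \sum_(x <- d1) \sum_(y <- d2) gr_elt (a@_x * b@_y) (x * y)%g.
Proof.
move=> le_d1 le_d2; rewrite /gr_mul (big_fset_incl _ le_d1) /=.
  apply/eq_bigr=> x _; apply/big_fset_incl => // y _ /mcoeff_outdom ->.
  by rewrite mulr0 gr_elt0.
move=> x _ /mcoeff_outdom ax.
by rewrite big1 // => y _; rewrite ax mul0r gr_elt0.
Qed.

Lemma gr_mul0 : left_zero 0 gr_mul.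
Proof. by move=> a; rewrite /gr_mul msupp0 big_seq_fset0. Qed.

Lemma gr_mulr0 : right_zero 0 gr_mul.
Proof.
by move=> a; rewrite /gr_mul big1 // => x _; rewrite msupp0 big_seq_fset0.
Qed.

Lemma gr_mulDl : left_distributive gr_mul +%R.
Proof.
move=> a b c.
rewrite (gr_mulw (fsubsetUl (msupp a) (msupp b)) (fsubset_refl (msupp c))).
rewrite (gr_mulw (fsubsetUr (msupp a) (msupp b)) (fsubset_refl (msupp c))).
rewrite (gr_mulw (msuppD_le a b) (fsubset_refl (msupp c))).
rewrite -big_split /=; apply/eq_bigr=> x _.
rewrite -big_split /=; apply/eq_bigr=> y _.
by rewrite mcoeffD mulrDl gr_eltD.
Qed.

Lemma gr_mulDr : right_distributive gr_mul +%R.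
Proof.
move=> a b c.
rewrite (gr_mulw (fsubset_refl (msupp a)) (fsubsetUl (msupp b) (msupp c))).
rewrite (gr_mulw (fsubset_refl (msupp a)) (fsubsetUr (msupp b) (msupp c))).
rewrite (gr_mulw (fsubset_refl (msupp a)) (msuppD_le b c)).
rewrite -big_split /=; apply/eq_bigr=> x _.
rewrite -big_split /=; apply/eq_bigr=> y _.
by rewrite mcoeffD mulrDr gr_eltD.
Qed.

Lemma gr_sum a : a = \sum_(x <- msupp a) gr_elt a@_x x.
Proof. exact: monalgE. Qed.

Lemma gr_mul_elt r s x y :
  gr_mul (gr_elt r x) (gr_elt s y) = gr_elt (r * s) (x * y)%g.
Proof. by rewrite (gr_mulw msuppU_le msuppU_le) !big_seq_fset1 !mcoeffUU. Qed.

Lemma gr_mul_suml I (l : seq I) (F : I -> group_ring R G) b :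
  gr_mul (\sum_(i <- l) F i) b = \sum_(i <- l) gr_mul (F i) b.
Proof.
exact: (big_morph (gr_mul^~ b) (fun _ _ => gr_mulDl _ _ _) (gr_mul0 _)).
Qed.

Lemma gr_mul_sumr I (l : seq I) (F : I -> group_ring R G) a :
  gr_mul a (\sum_(i <- l) F i) = \sum_(i <- l) gr_mul a (F i).
Proof.
exact: (big_morph (gr_mul a) (fun _ _ => gr_mulDr _ _ _) (gr_mulr0 _)).
Qed.

Fact gr_mulA : associative gr_mul.
Proof.
move=> a b c; rewrite (gr_sum a) !gr_mul_suml; apply/eq_bigr=> x _.
rewrite (gr_sum b) gr_mul_suml !gr_mul_sumr gr_mul_suml; apply/eq_bigr=> y _.
rewrite (gr_sum c) !gr_mul_sumr; apply/eq_bigr=> z _.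
by rewrite !gr_mul_elt mulrA mulgA.
Qed.

Fact gr_mul1 : left_id gr_one gr_mul.
Proof.
move=> a; rewrite [in LHS](gr_sum a) [in RHS](gr_sum a) gr_mul_sumr.
by apply/eq_bigr=> x _; rewrite gr_mul_elt mul1r mul1g.
Qed.

Fact gr_mulr1 : right_id gr_one gr_mul.
Proof.
move=> a; rewrite [in LHS](gr_sum a) [in RHS](gr_sum a) gr_mul_suml.
by apply/eq_bigr=> x _; rewrite gr_mul_elt mulr1 mulg1.
Qed.

Fact gr_one_neq0 : gr_one != 0.
Proof. by rewrite [_ == _]monalgU_eq0 oner_eq0. Qed.

HB.instance Definition _ := GRing.Zmodule_isNzRing.Build (group_ring R G)
  gr_mulA gr_mul1 gr_mulr1 gr_mulDl gr_mulDr gr_one_neq0.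

End GroupRing.

(* FPS f is the formal power series \sum_k f k t^k. *)
Record fps (R : Type) := FPS { fps_coef : nat -> R }.

Section FormalPowerSeries.

Variable R : comNzRingType.

Implicit Types f g h : fps R.

HB.instance Definition _ := gen_eqMixin (fps R).
HB.instance Definition _ := gen_choiceMixin (fps R).

Lemma fpsP f g : fps_coef f =1 fps_coef g -> f = g.
Proof. by case: f g => [f] [g] /= /funext ->. Qed.

Definition fps_zero : fps R := FPS (fun=> 0).
Definition fps_opp f := FPS (fun k => - fps_coef f k).
Definition fps_add f g := FPS (fun k => fps_coef f k + fps_coef g k).
Definition fps_one : fps R := FPS (fun k => (k == 0)%N%:R).
Definition fps_mul f g :=
  FPS (fun k => \sum_(i < k.+1) fps_coef f i * fps_coef g (k - i)).

Fact fps_addA : associative fps_add.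
Proof. by move=> f g h; apply: fpsP => k /=; rewrite addrA. Qed.

Fact fps_addC : commutative fps_add.
Proof. by move=> f g; apply: fpsP => k /=; rewrite addrC. Qed.

Fact fps_add0 : left_id fps_zero fps_add.
Proof. by move=> f; apply: fpsP => k /=; rewrite add0r. Qed.

Fact fps_addN : left_inverse fps_zero fps_opp fps_add.
Proof. by move=> f; apply: fpsP => k /=; rewrite addNr. Qed.

HB.instance Definition _ :=
  GRing.isZmodule.Build (fps R) fps_addA fps_addC fps_add0 fps_addN.

Definition fps_trunc m f : {poly R} := \poly_(i < m.+1) fps_coef f i.

Lemma fps_truncE m f i : (i <= m)%N -> (fps_trunc m f)`_i = fps_coef f i.
Proof. by rewrite coef_poly ltnS => ->. Qed.

Lemma fps_mul_trunc m f g k : (k <= m)%N ->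
  fps_coef (fps_mul f g) k = (fps_trunc m f * fps_trunc m g)`_k.
Proof.
move=> le_km; rewrite coefM; apply: eq_bigr => i _.
rewrite !fps_truncE ?(leq_trans (leq_subr _ _)) //.
by apply: leq_trans le_km; rewrite -ltnS.
Qed.

Fact fps_mulC : commutative fps_mul.
Proof.
by move=> f g; apply: fpsP => k; rewrite !(fps_mul_trunc _ _ (leqnn k)) mulrC.
Qed.

Fact fps_mulA : associative fps_mul.
Proof.
have tM u v w k : fps_coef (fps_mul u (fps_mul v w)) k =
    (fps_trunc k u * (fps_trunc k v * fps_trunc k w))`_k.
  rewrite (fps_mul_trunc _ _ (leqnn k)) !coefM; apply: eq_bigr => i _.
  by rewrite (fps_truncE _ (leq_subr i k)) (fps_mul_trunc _ _ (leq_subr i k)).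
move=> f g h; apply: fpsP => k.
by rewrite [in RHS]fps_mulC !tM [in RHS]mulrC mulrA.
Qed.

Fact fps_mul1 : left_id fps_one fps_mul.
Proof.
move=> f; apply: fpsP => k /=.
rewrite big_ord_recl /= mul1r subn0 big1 ?addr0 // => i _.
by rewrite mul0r.
Qed.

Fact fps_mulDl : left_distributive fps_mul +%R.
Proof.
move=> f g h; apply: fpsP => k /=; rewrite -big_split /=.
by apply: eq_bigr => i _; rewrite mulrDl.
Qed.

Fact fps_one_neq0 : fps_one != 0.
Proof.
by apply/eqP => /(congr1 (fun f => fps_coef f 0)) /eqP; rewrite /= oner_eq0.
Qed.

HB.instance Definition _ := GRing.Zmodule_isComNzRing.Build (fps R)
  fps_mulA fps_mulC fps_mul1 fps_mulDl fps_one_neq0.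

Lemma fps_coefM f g k :
  fps_coef (f * g) k = \sum_(i < k.+1) fps_coef f i * fps_coef g (k - i).
Proof. by []. Qed.

Lemma fps_coefX_lt f k m :
  fps_coef f 0 = 0 -> (m < k)%N -> fps_coef (f ^+ k) m = 0.
Proof.
move=> f0; elim: k m => // k IHk m lt_mk.
rewrite exprS fps_coefM big_ord_recl f0 mul0r add0r big1 // => i _.
rewrite /bump /= IHk ?mulr0 //.
by apply: leq_trans (ltnSE lt_mk); rewrite ltn_subLR ?addSn ?ltnS ?leq_addl.
Qed.

Definition fps_of_poly (p : {poly R}) : fps R := FPS (fun k => p`_k).

Fact fps_of_poly_is_additive : {morph fps_of_poly : p q / p - q}.
Proof. by move=> p q; apply: fpsP => k /=; rewrite coefB. Qed.

Fact fps_of_poly_is_monoid_morphism : monoid_morphism fps_of_poly.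
Proof.
split; first by apply: fpsP => k /=; rewrite coef1.
by move=> p q; apply: fpsP => k; rewrite fps_coefM /= coefM.
Qed.

HB.instance Definition _ := GRing.isZmodMorphism.Build {poly R} (fps R)
  fps_of_poly fps_of_poly_is_additive.
HB.instance Definition _ := GRing.isMonoidMorphism.Build {poly R} (fps R)
  fps_of_poly fps_of_poly_is_monoid_morphism.

(* In Q : {poly {poly R}}, the inner variable is t and the outer one is z, so
   that root (map_poly fps_of_poly Q) P means Q(t, P(t)) = 0. *)
Definition fps_algebraic (P : fps R) : Prop :=
  exists2 Q : {poly {poly R}}, Q != 0 & root (map_poly fps_of_poly Q) P.

End FormalPowerSeries.

(* The coefficient of t^m in \sum_k f^k / k!. Only meaningful when f has zero
   constant term: then t^k divides f^k, and the terms with k > m are 0. *)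
Definition fps_exp (F : numFieldType) (f : fps F) : fps F :=
  FPS (fun m => \sum_(k < m.+1) fps_coef (f ^+ k) m / k`!%:R).

Lemma fps_coef_exp (F : numFieldType) (f : fps F) m N :
    fps_coef f 0 = 0 -> (m < N)%N ->
  fps_coef (fps_exp f) m = \sum_(k < N) fps_coef (f ^+ k) m / k`!%:R.
Proof.
move=> f0 lt_mN; rewrite /= (big_ord_widen _ (fun k =>
  fps_coef (f ^+ k) m / k`!%:R) lt_mN) big_mkcond.
apply: eq_bigr => k _; case: ltnP => // lt_mk.
by rewrite fps_coefX_lt ?mul0r.
Qed.

(* \sum_(k >= 1) Tr(a^k) / k t^k *)
Definition trace_series (F : numFieldType) (G : groupType) (a : group_ring F G) :
    fps F :=
  FPS (fun k => if k == 0%N then 0 else gr_trace (a ^+ k) / k%:R).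

(* Main.v *)
(** Write P for the series and Tr for the trace of matrices over the group ring.
  Formally P(t) = det(1 - t a).  Padding the words of a to a common length l
  and reading them on cyclic automata that share one state gives a matrix b
  whose entries are linear in the letters and satisfy Tr(b^(kl)) = l Tr(a^k),
  Tr(b^m) = 0 when l does not divide m; hence it is enough to treat
  P_b(t) = P(t^l).

  For b = B_0 + sum_s B_s s the walk on the Cayley tree is governed by the
  unique power series solution of the polynomial system
    D_s K_s = 1,  K_s = 1 - A_0 - sum_(v <> s) A_v D_(v^-1) A_(v^-1),  A = t B,
  and the diagonal of (1 - t b)^-1 is H^-1 where
  H = 1 - A_0 - sum_v A_v D_(v^-1) A_(v^-1).  Comparing logarithmic derivatives
  gives the closed formula
    P_b^2 det(H)^(2n) = det(H)^2 prod_s det(K_s).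

  A derivation of the fraction field of C[[t]] that kills C(t) kills the D_s,
  because their derivatives solve a linear contracting system; so it kills P_b.
  In characteristic 0 an element killed by all such derivations is algebraic,
  since a derivation extends along any field extension (Zorn). *)

From HB Require Import structures.
Require Import Defs.
From mathcomp Require Import all_boot all_order all_algebra.
From mathcomp Require Import finmap boolp classical_sets reals complex.
From mathcomp.multinomials Require Import monalg.
From mathcomp Require Import ring zify.

Set Implicit Arguments.
Unset Strict Implicit.
Unset Printing Implicit Defensive.

Import GRing.Theory Num.Theory.

Local Open Scope ring_scope.

(** * Derivations and algebraicity *)

Definition derivation (R : nzRingType) (d : R -> R) : Prop :=
  {morph d : x y / x - y} /\ (forall x y, d (x * y) = d x * y + x * d y).

Section DerivationExtension.

Variable L : fieldType.
Hypothesis pchar0 : forall n : nat, n.+1%:R != 0 :> L.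

(* A derivation defined on a subring of L, represented by its graph. *)
Definition der_graph (S : set (L * L)) : Prop :=
  [/\ S (1, 0),
      forall u v, S u -> S v -> S (u.1 - v.1, u.2 - v.2),
      forall u v, S u -> S v -> S (u.1 * v.1, u.1 * v.2 + u.2 * v.1)
    & forall y, S (0, y) -> y = 0].

(** Here [q] is [p] with the derivation applied to each coefficient. *)
Definition poly_graph (S : set (L * L)) (p q : {poly L}) : Prop :=
  forall i, S (p`_i, q`_i).

(** The derivative of [p.[z]] that the Leibniz rule forces once [z] is sent to [e]. *)
Definition graph_eval (z e : L) (p q : {poly L}) : L := q.[z] + e * p^`().[z].

Definition graph_adjoin (S : set (L * L)) (z e : L) : set (L * L) :=
  [set u | exists p q, poly_graph S p q /\ u = (p.[z], graph_eval z e p q)]%classic.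


Section Adjoin.

Variable S : set (L * L).
Hypothesis Sder : der_graph S.

Lemma der_graph0 : S (0, 0).
Proof. by case: Sder => S1 SB _ _; have := SB _ _ S1 S1; rewrite /= !subrr. Qed.

Lemma der_graphN u : S u -> S (- u.1, - u.2).
Proof.
by case: Sder => _ SB _ _ Su; have := SB _ _ der_graph0 Su; rewrite /= !sub0r.
Qed.

Lemma der_graphD u v : S u -> S v -> S (u.1 + v.1, u.2 + v.2).
Proof.
case: Sder => _ SB _ _ Su Sv; have := SB _ _ Su (der_graphN Sv).
by rewrite /= !opprK.
Qed.

Lemma der_graph_sum (I : Type) (r : seq I) (f g : I -> L) :
  (forall i, S (f i, g i)) -> S (\sum_(i <- r) f i, \sum_(i <- r) g i).
Proof.
move=> Sfg; elim: r => [|i r IHr]; first by rewrite !big_nil; apply: der_graph0.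
by rewrite !big_cons; apply: (der_graphD (Sfg i) IHr).
Qed.

Lemma der_graph_nat n : S (n%:R, 0).
Proof.
case: Sder => S1 _ _ _; elim: n => [|n IHn]; first exact: der_graph0.
by have := der_graphD S1 IHn; rewrite /= -natr1 addrC addr0.
Qed.

Lemma der_graph_fun x y y' : S (x, y) -> S (x, y') -> y = y'.
Proof.
case: Sder => _ SB _ S0 Sxy Sxy'; apply/subr0_eq/S0.
by have := SB _ _ Sxy Sxy'; rewrite /= subrr.
Qed.

Lemma poly_graphB p q p1 q1 : poly_graph S p q -> poly_graph S p1 q1 ->
  poly_graph S (p - p1) (q - q1).
Proof.
move=> Sp Sp1 i; rewrite !coefB; case: Sder => _ SB _ _.
exact: (SB _ _ (Sp i) (Sp1 i)).
Qed.

Lemma poly_graphM p q p1 q1 : poly_graph S p q -> poly_graph S p1 q1 ->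
  poly_graph S (p * p1) (p * q1 + q * p1).
Proof.
move=> Sp Sp1 i; rewrite coefD !coefM -big_split /=.
by apply: der_graph_sum => j; case: Sder => _ _ SM _; apply: (SM _ _ (Sp j) (Sp1 _)).
Qed.

Lemma poly_graphC x y : S (x, y) -> poly_graph S x%:P y%:P.
Proof.
by move=> Sxy i; rewrite !coefC; case: ifP => // _; apply: der_graph0.
Qed.

Lemma poly_graphXn n : poly_graph S 'X^n 0.
Proof. by move=> i; rewrite coefXn coef0; apply: der_graph_nat. Qed.

Lemma poly_graph_deriv p q : poly_graph S p q -> poly_graph S p^`() q^`().
Proof.
move=> Sp i; rewrite !coef_deriv -[p`_ _ *+ _]mulr_natr -[q`_ _ *+ _]mulr_natr.
case: Sder => _ _ SM _.
by have := SM _ _ (Sp i.+1) (der_graph_nat i.+1); rewrite /= mulr0 add0r.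
Qed.

Lemma graph_evalB z e p q p1 q1 :
  graph_eval z e (p - p1) (q - q1) = graph_eval z e p q - graph_eval z e p1 q1.
Proof. by rewrite /graph_eval derivB !hornerE; ring. Qed.

Lemma graph_evalM z e p q p1 q1 :
  graph_eval z e (p * p1) (p * q1 + q * p1) =
  p.[z] * graph_eval z e p1 q1 + graph_eval z e p q * p1.[z].
Proof. by rewrite /graph_eval derivM !hornerE; ring. Qed.

(** The Leibniz rule is built into [graph_eval], so the only obstruction to sending [z] to [e] is
    well-definedness: a polynomial vanishing at [z] must receive derivative 0. *)
Lemma graph_adjoinP z e :
    (forall p q, poly_graph S p q -> p.[z] = 0 -> graph_eval z e p q = 0) ->
  [/\ der_graph (graph_adjoin S z e), subset S (graph_adjoin S z e)
    & graph_adjoin S z e (z, e)].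
Proof.
move=> zS; have sub : subset S (graph_adjoin S z e).
  move=> [x y] Sxy; exists x%:P, y%:P; split; first exact: poly_graphC.
  by rewrite /graph_eval derivC !hornerE.
split=> //; last first.
  exists 'X, 0; split; first exact: (poly_graphXn 1).
  by rewrite /graph_eval derivX !hornerE.
split.
- by apply: sub; case: Sder.
- move=> _ _ [p [q [Sp ->]]] [p1 [q1 [Sp1 ->]]] /=; exists (p - p1), (q - q1).
  by split; [apply: poly_graphB|rewrite graph_evalB !hornerE].
- move=> _ _ [p [q [Sp ->]]] [p1 [q1 [Sp1 ->]]] /=.
  exists (p * p1), (p * q1 + q * p1).
  by split; [apply: poly_graphM|rewrite graph_evalM !hornerE].
- by move=> y [p [q [Sp [p0 ->]]]]; apply: zS.
Qed.

Lemma poly_graph0 q : poly_graph S 0 q -> q = 0.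
Proof.
move=> S0; apply/polyP => i; rewrite coef0; case: Sder => _ _ _; apply.
by have := S0 i; rewrite coef0.
Qed.

(** If [z] is transcendental over the domain of [S], any [e] works. Otherwise a relation of least
    degree forces [e], and pseudo-division by it shows that every other relation is respected. *)
Lemma graph_adjoin_exists z :
  exists e, forall p q, poly_graph S p q -> p.[z] = 0 -> graph_eval z e p q = 0.
Proof.
pose annih n := exists p q,
  [/\ poly_graph S p q, p.[z] = 0, p != 0 & size p = n].
case: (pselect (exists n, annih n)) => [exn|nex]; last first.
  exists 0 => p q Sp pz.
  have [p0|pn0] := eqVneq p 0; last by case: nex; exists (size p), p, q.
  move: Sp; rewrite p0 => /poly_graph0 ->.
  by rewrite /graph_eval deriv0 !hornerE.
have exb : exists n, `[< annih n >] by case: exn => n ?; exists n; apply/asboolP.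
case: (ex_minnP exb) => n /asboolP[p0 [q0 [Sp0 p0z p0n0 sp0]]] minn.
have sz1 : (1 < size p0)%N.
  rewrite ltnNge; apply/negP => /size1_polyC p0C.
  by move: p0z p0n0; rewrite p0C hornerC => ->; rewrite polyC0 eqxx.
(* A nonconstant polynomial has a nonzero derivative in characteristic 0. *)
have p0' : p0^`() != 0.
  apply/eqP => /polyP /(_ (size p0).-2); rewrite coef_deriv coef0.
  have -> : (size p0).-2.+1 = (size p0).-1 by case: (size p0) sz1 => [|[|]].
  rewrite -mulr_natr => /eqP; rewrite mulf_eq0 -[p0`_ _]/(lead_coef p0).
  rewrite lead_coef_eq0 (negbTE p0n0) /=.
  by case: (size p0) sz1 => [|[|m]] //= _; rewrite (negbTE (pchar0 _)).
(* Otherwise the derivative of [p0] would be a shorter relation for [z]. *)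
have p0'z : p0^`().[z] != 0.
  apply/eqP => p0'z; have := minn (size p0^`()).
  rewrite leqNgt -sp0 lt_size_deriv // => /(_ _)/negP; case=> //.
  apply/asboolP; exists p0^`(), q0^`(); split=> //.
  exact: poly_graph_deriv.
(* The unique solution of [graph_eval z e p0 q0 = 0]. *)
pose e := - q0.[z] / p0^`().[z]; exists e.
have ev0 : graph_eval z e p0 q0 = 0 by rewrite /graph_eval divfK // addrN.
move=> p; move: {2}(size p).+1 (ltnSn (size p)) => m.
elim: m p => // m IHm p; rewrite ltnS => le_pm q Sp pz.
have [p_eq0|pn0] := eqVneq p 0.
  move: Sp; rewrite p_eq0 => /poly_graph0 ->.
  by rewrite /graph_eval deriv0 !hornerE.
have le_p0p : (size p0 <= size p)%N.
  by rewrite sp0; apply: minn; apply/asboolP; exists p, q.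
(* The domain of [S] is only a ring, so the leading terms are cancelled by cross-multiplying with
   both leading coefficients. *)
pose c := lead_coef p0; pose d := lead_coef p.
pose c' := q0`_(size p0).-1; pose d' := q`_(size p).-1.
pose k := (size p - size p0)%N.
have Sc : poly_graph S c%:P c'%:P by apply: poly_graphC; apply: Sp0.
have Sd : poly_graph S d%:P d'%:P by apply: poly_graphC; apply: Sp.
have S2 := poly_graphM Sd (poly_graphM (poly_graphXn k) Sp0).
have {S2} := poly_graphB (poly_graphM Sc Sp) S2.
set p2 := _ - _; set q2 := _ - _ => S2.
have p2z : p2.[z] = 0 by rewrite /p2 hornerD hornerN !hornerM pz p0z !mulr0 subrr.
have lt_p2 : (size p2 < m)%N.
  apply: leq_trans le_pm; rewrite /p2.
  have cn0 : c != 0 by rewrite lead_coef_eq0.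
  have dn0 : d != 0 by rewrite lead_coef_eq0.
  have s1 : size (c%:P * p) = size p by rewrite mul_polyC size_scale.
  have s2 : size (d%:P * ('X^k * p0)) = size p.
    by rewrite mul_polyC size_scale // size_monicM ?monicXn // size_polyXn /k addSn /= subnK.
  have pgt0 : (0 < size p)%N by rewrite lt0n size_poly_eq0.
  rewrite -(ltn_predK pgt0) ltnS; apply/leq_sizeP => j.
  rewrite leq_eqVlt => /predU1P[<-|lt_j]; last first.
    by rewrite coefB !nth_default ?subr0 ?s1 ?s2 //; lia.
  rewrite coefB -{1}s1 -s2 -!/(lead_coef _) !lead_coefM !lead_coefC.
  by rewrite lead_coefXn mul1r mulrC subrr.
have := IHm _ lt_p2 _ S2 p2z.
rewrite graph_evalB !graph_evalM ev0 !hornerM p0z pz !(mulr0, mul0r, addr0, subr0) hornerC.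
move/eqP; rewrite mulf_eq0 lead_coef_eq0 (negbTE p0n0) => /eqP; exact.
Qed.

End Adjoin.

(** Zorn's lemma on the graphs containing [S]: a maximal one is total, since otherwise one more
    element could be adjoined. *)
Lemma derivation_extension (S : set (L * L)) : der_graph S ->
  exists2 d : L -> L, derivation d & forall u, S u -> d u.1 = u.2.
Proof.
(* The empty set satisfies [P] because it is the union of the empty chain; maximality excludes it
   afterwards. *)
move=> Sder; pose P (A : set (L * L)) :=
  (exists u, A u) -> der_graph A /\ subset S A.
have chainP (F : set (set (L * L))) :
    subset F P -> total_on F subset -> P (\bigcup_(X in F) X)%classic.
  move=> FP Ft [u0 [X0 FX0 X0u0]].
  have pair u v : (\bigcup_(X in F) X)%classic u -> (\bigcup_(X in F) X)%classic v ->
      exists X, [/\ F X, X u, X v & der_graph X].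
    move=> [X FX Xu] [Y FY Yv]; have [XY|YX] := Ft _ _ FX FY.
      exists Y; split=> //; first exact: XY.
      by case: (FP _ FY) => //; exists v.
    exists X; split=> //; first exact: YX.
    by case: (FP _ FX) => //; exists u.
  case: (FP _ FX0); first by exists u0.
  move=> X0d SX0; split; last by move=> u /SX0 X0u; exists X0.
  split.
  - by exists X0 => //; case: X0d.
  - move=> u v /pair uv /uv[X [FX Xu Xv [_ XB _ _]]].
    by exists X => //; apply: XB.
  - move=> u v /pair uv /uv[X [FX Xu Xv [_ _ XM _]]].
    by exists X => //; apply: XM.
  - move=> y yF; have [X [_ Xy _ [_ _ _ Xfun]]] := pair _ _ yF yF.
    exact: Xfun.
have [A [PA maxA]] := Zorn_bigcup chainP.
have [Ader SA] : der_graph A /\ subset S A.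
  case: (pselect (exists u, A u)) => [/PA //|A0].
  case: (maxA S); last by move=> _; split.
  split; last by case: Sder => S1 _ _ _ /(_ _ S1) ?; apply: A0; exists (1, 0).
  by move=> u Au; case: A0; exists u.
have totA z : exists y, A (z, y).
  have [e /(graph_adjoinP Ader)[Bder AB Bz]] := graph_adjoin_exists Ader z.
  case: (pselect (exists y, A (z, y))) => // nAz.
  case: (maxA (graph_adjoin A z e)).
    by split=> // /(_ _ Bz) ?; apply: nAz; exists e.
  by move=> _; split=> // u /SA /AB.
have [d Ad] := choice totA; exists d; last first.
  by move=> [x y] /SA Axy; apply: (der_graph_fun Ader (Ad x) Axy).
have [A1 AB AM A0] := Ader.
split=> x y; apply: (der_graph_fun Ader (Ad _)).
  exact: (AB _ _ (Ad x) (Ad y)).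
by rewrite addrC; apply: (AM _ _ (Ad x) (Ad y)).
Qed.

(** If [y] satisfied no relation over the image of [phi], the zero derivation of that image would
    extend by sending [y] to 1, and then to all of [L], against the hypothesis. *)
Lemma algebraic_of_derivations (K : comNzRingType) (phi : {rmorphism K -> L})
    (y : L) :
    (forall d : L -> L, derivation d -> (forall x, d (phi x) = 0) -> d y = 0) ->
  exists2 Q : {poly K}, Q != 0 & root (map_poly phi Q) y.
Proof.
move=> dy0; case: (pselect (exists2 Q : {poly K}, Q != 0 & root (map_poly phi Q) y)) => // nQ.
pose S0 : set (L * L) := [set u | exists x, u = (phi x, 0)]%classic.
have S0der : der_graph S0.
  split.
  - by exists 1; rewrite rmorph1.
  - by move=> _ _ [x ->] [x1 ->]; exists (x - x1); rewrite /= rmorphB subrr.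
  - by move=> _ _ [x ->] [x1 ->]; exists (x * x1); rewrite /= rmorphM mulr0 mul0r addr0.
  - by move=> z [x []].
have S0y p q : poly_graph S0 p q -> p.[y] = 0 -> graph_eval y 1 p q = 0.
  move=> Sp py; have [c Ec] := choice Sp.
  pose Q := \poly_(i < size p) c i.
  have EQ : map_poly phi Q = p.
    apply/polyP => i; rewrite coef_map coef_poly; case: ltnP => [_|le].
      by case: (Ec i) => ->.
    by rewrite nth_default //; apply: rmorph0.
  have p0 : p = 0.
    apply/eqP; apply: contraT => pn0; case: nQ; exists Q.
      by apply: contraNneq pn0 => Q0; rewrite -EQ Q0 rmorph0.
    by rewrite EQ; apply/rootP.
  move: Sp; rewrite p0 => /(poly_graph0 S0der) ->.
  by rewrite /graph_eval deriv0 !hornerE.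
have [Sder S0S Sy] := graph_adjoinP S0der S0y.
have [d dder dS] := derivation_extension Sder.
have /= := dS _ Sy; rewrite (dy0 d dder) => [/esym/eqP|x]; first by rewrite oner_eq0.
by apply: (dS (phi x, 0)); apply: S0S; exists x.
Qed.

End DerivationExtension.

(** * Power series and matrices of power series *)

Section FractionDenominators.

Variable R : idomainType.

Local Notation "x %:F" := (tofrac x).

Lemma fraction_denom (x : {fraction R}) :
  exists2 d : R, d != 0 & exists n : R, d%:F * x = n%:F.
Proof.
elim/quotW: x => r; exists (\d_r); first exact: denom_ratioP.
exists (\n_r); rewrite !piE; apply/eqmodP; rewrite /= FracField.equivfE /FracField.mulf.
by rewrite !numden_Ratio ?mulf_neq0 ?oner_neq0 ?denom_ratioP // !mulr1 !mul1r mulrC.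
Qed.

(** Serves to turn a finite family of derivatives in the fraction field into power series, to which
    congruences modulo powers of [t] apply. *)
Lemma fraction_common_denom (I : finType) (x : I -> {fraction R}) :
  exists2 d : R, d != 0 & exists y : I -> R, forall i, d%:F * x i = (y i)%:F.
Proof.
have /choice[dn dnP] i : exists dn : R * R, dn.1 != 0 /\ dn.1%:F * x i = dn.2%:F.
  by have [d d0 [m E]] := fraction_denom (x i); exists (d, m).
exists (\prod_i (dn i).1); first by apply/prodf_neq0 => i _; case: (dnP i).
exists (fun i => (\prod_(j | j != i) (dn j).1) * (dn i).2) => i.
have [_ E] := dnP i.
by rewrite (bigD1 i) //= !rmorphM /= -E mulrCA mulrA.
Qed.

End FractionDenominators.

Section FpsUnitRing.

Variable R : comNzRingType.

Implicit Types f g : fps R.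

(** Units and inverses are obtained classically; they supply the structure from which the fraction
    field of [fps R] is formed. *)
Definition fps_unit f : bool := `[< exists g, g * f = 1 >].

Definition fps_inv f : fps R :=
  if pselect (exists g, g * f = 1) is left ex then projT1 (cid ex) else f.

Fact fps_mulVf : {in fps_unit, left_inverse 1 fps_inv *%R}.
Proof.
move=> f; rewrite unfold_in => /asboolP ex; rewrite /fps_inv.
by case: pselect => // ex'; case: cid.
Qed.

Fact fps_unitP f g : g * f = 1 -> fps_unit f.
Proof. by move=> gf; apply/asboolP; exists g. Qed.

Fact fps_inv_out : {in [predC fps_unit], fps_inv =1 id}.
Proof.
move=> f; rewrite inE unfold_in => /asboolP nex; rewrite /fps_inv.
by case: pselect.
Qed.

HB.instance Definition _ := GRing.ComNzRing_hasMulInverse.Build (fps R)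
  fps_mulVf fps_unitP fps_inv_out.

End FpsUnitRing.

Section FpsIdomain.

Variable R : idomainType.

Implicit Types f g : fps R.

Lemma fps_neq0_order f : f != 0 ->
  exists2 i, fps_coef f i != 0 & forall j, (j < i)%N -> fps_coef f j = 0.
Proof.
move=> fn0; have ex : exists i, fps_coef f i != 0.
  apply: contrapT => nex; case/eqP: fn0; apply: fpsP => i.
  by apply/eqP; apply: contrapT => /negP fi; apply: nex; exists i.
case: (ex_minnP ex) => i fi mini; exists i => // j lt_ji.
by apply/eqP; apply: contraLR lt_ji; rewrite -leqNgt; apply: mini.
Qed.

(** The product of the lowest nonzero coefficients of two nonzero series is a coefficient of their
    product. *)
Fact fps_integral f g : f * g = 0 -> (f == 0) || (g == 0).
Proof.
move=> fg0; case: (boolP (f == 0)) => //= /fps_neq0_order[i fi mini].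
apply: contraT => /fps_neq0_order[j gj minj].
have := congr1 (fun h => fps_coef h (i + j)%N) fg0.
rewrite fps_coefM.
have lt_i : (i < (i + j).+1)%N by rewrite ltnS leq_addr.
rewrite (bigD1 (Ordinal lt_i)) //= addKn big1 => [|k nek].
  by rewrite addr0 => /eqP; rewrite mulf_eq0 (negbTE fi) (negbTE gj).
have [lt_ki|le_ik] := ltnP k i; first by rewrite mini ?mul0r.
rewrite minj ?mulr0 //.
have : (k : nat) != i by apply: contraNneq nek => E; apply/eqP/val_inj.
by have := ltn_ord k; lia.
Qed.

HB.instance Definition _ := GRing.ComUnitRing_isIntegral.Build (fps R) fps_integral.

End FpsIdomain.

Section FpsMorphisms.

Variable R : comNzRingType.

Implicit Types f g : fps R.

Definition fpsC (c : R) : fps R := fps_of_poly c%:P.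

Fact fpsC_is_zmod_morphism : zmod_morphism fpsC.
Proof. by move=> c d; rewrite /fpsC !rmorphB. Qed.

Fact fpsC_is_monoid_morphism : monoid_morphism fpsC.
Proof. by split=> [|c d]; rewrite /fpsC ?rmorph1 // !rmorphM. Qed.

HB.instance Definition _ :=
  GRing.isZmodMorphism.Build R (fps R) fpsC fpsC_is_zmod_morphism.
HB.instance Definition _ :=
  GRing.isMonoidMorphism.Build R (fps R) fpsC fpsC_is_monoid_morphism.

Definition fpsX : fps R := fps_of_poly 'X.

Definition fps_ev0 (f : fps R) : R := fps_coef f 0.

Fact fps_ev0_is_zmod_morphism : zmod_morphism fps_ev0.
Proof. by []. Qed.

Fact fps_ev0_is_monoid_morphism : monoid_morphism fps_ev0.
Proof. by split=> // f g; rewrite /fps_ev0 fps_coefM big_ord1. Qed.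

HB.instance Definition _ :=
  GRing.isZmodMorphism.Build (fps R) R fps_ev0 fps_ev0_is_zmod_morphism.
HB.instance Definition _ :=
  GRing.isMonoidMorphism.Build (fps R) R fps_ev0 fps_ev0_is_monoid_morphism.

Lemma fps_coefXM f m :
  fps_coef (fpsX * f) m = if m is k.+1 then fps_coef f k else 0.
Proof.
rewrite fps_coefM; case: m => [|k]; first by rewrite big_ord1 /= coefX mul0r.
rewrite big_ord_recl big_ord_recl big1 /= => [|i _].
  by rewrite !coefX /= mul0r add0r mul1r addr0 subn1.
by rewrite coefX mul0r.
Qed.

Lemma fps_coef_add f g m : fps_coef (f + g) m = fps_coef f m + fps_coef g m.
Proof. by []. Qed.

Lemma fps_coef_opp f m : fps_coef (- f) m = - fps_coef f m.
Proof. by []. Qed.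

Lemma fps_coef_sum (I : Type) (r : seq I) (P : pred I) (f : I -> fps R) m :
  fps_coef (\sum_(i <- r | P i) f i) m = \sum_(i <- r | P i) fps_coef (f i) m.
Proof. by apply: (big_morph (fun f => fps_coef f m)). Qed.

Lemma fps_coefCM c f m : fps_coef (fpsC c * f) m = c * fps_coef f m.
Proof.
rewrite fps_coefM big_ord_recl /= coefC eqxx subn0 big1 ?addr0 // => i _.
by rewrite coefC mul0r.
Qed.

End FpsMorphisms.

Arguments fps_ev0 : simpl never.

Section MatrixCongruence.

Variable R : comNzRingType.

(* Congruence modulo t^k. *)
Definition mx_eqmod (k : nat) (p q : nat) (A B : 'M[fps R]_(p, q)) : Prop :=
  forall i j m, (m < k)%N -> fps_coef (A i j) m = fps_coef (B i j) m.

Variables (k p q : nat).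
Implicit Types A B C : 'M[fps R]_(p, q).

Lemma mx_eqmod_refl A : mx_eqmod k A A.
Proof. by []. Qed.

Lemma mx_eqmodD A B A1 B1 : mx_eqmod k A B -> mx_eqmod k A1 B1 ->
  mx_eqmod k (A + A1) (B + B1).
Proof.
by move=> AB AB1 i j m lt_m; rewrite !mxE !fps_coef_add AB ?AB1.
Qed.

Lemma mx_eqmod_sum (I : Type) (r : seq I) (P : pred I)
    (A B : I -> 'M[fps R]_(p, q)) :
  (forall i, mx_eqmod k (A i) (B i)) ->
  mx_eqmod k (\sum_(i <- r | P i) A i) (\sum_(i <- r | P i) B i).
Proof.
by move=> AB; elim/big_rec2: _ => // i x y _; apply: mx_eqmodD.
Qed.

Lemma mx_eqmodM r A B (A1 B1 : 'M[fps R]_(q, r)) :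
  mx_eqmod k A B -> mx_eqmod k A1 B1 -> mx_eqmod k (A *m A1) (B *m B1).
Proof.
move=> AB AB1 i j m lt_m; rewrite !mxE !fps_coef_sum; apply: eq_bigr => l _.
rewrite !fps_coefM; apply: eq_bigr => u _.
have lt_u := ltn_ord u; rewrite AB ?AB1 //; lia.
Qed.

Lemma mx_eqmodX A B : mx_eqmod k A B -> mx_eqmod k.+1 (fpsX R *: A) (fpsX R *: B).
Proof.
by move=> AB i j [|m] lt_m; rewrite !mxE !fps_coefXM // AB.
Qed.

Lemma mx_eqmodW j A B : (j <= k)%N -> mx_eqmod k A B -> mx_eqmod j A B.
Proof. by move=> le_jk AB a b m lt_m; apply: AB; apply: leq_trans le_jk. Qed.

Lemma mx_eqmod_trans A B C : mx_eqmod k A B -> mx_eqmod k B C -> mx_eqmod k A C.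
Proof. by move=> AB BC a b m lt_m; rewrite AB ?BC. Qed.

Lemma mx_eqmod_sym A B : mx_eqmod k A B -> mx_eqmod k B A.
Proof. by move=> AB a b m lt_m; rewrite AB. Qed.

End MatrixCongruence.

(** * Fixed points of contractions for the t-adic metric *)

Section Contraction.

Variables (R : comNzRingType) (T : Type) (p q : nat).
Variable Phi : (T -> 'M[fps R]_(p, q)) -> T -> 'M[fps R]_(p, q).
Hypothesis PhiC : forall k x y,
  (forall s, mx_eqmod k (x s) (y s)) -> forall s, mx_eqmod k.+1 (Phi x s) (Phi y s).

Lemma mx_eqmod_eq (A B : 'M[fps R]_(p, q)) : (forall k, mx_eqmod k A B) -> A = B.
Proof. by move=> AB; apply/matrixP => i j; apply: fpsP => m; apply: (AB m.+1). Qed.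

Lemma contraction_unique x y :
  (forall s, Phi x s = x s) -> (forall s, Phi y s = y s) -> forall s, x s = y s.
Proof.
move=> Ex Ey s; apply: mx_eqmod_eq => k; elim: k s => // k IHk s.
by rewrite -Ex -Ey; apply: PhiC.
Qed.

(** The iterates from 0 stabilize modulo higher and higher powers of [t]. *)
Lemma contraction_fixpoint : exists x, forall s, Phi x s = x s.
Proof.
pose it k := iter k Phi (fun=> 0).
have itS k s : mx_eqmod k (it k s) (it k.+1 s) by elim: k s => //= k IHk; apply: PhiC.
have itD k j s : mx_eqmod k (it k s) (it (j + k)%N s).
  elim: j => [|j IHj] // => //.
  apply: mx_eqmod_trans IHj _; rewrite addSn; apply: mx_eqmodW (itS _ s).
  exact: leq_addl.
(* Coefficient [m] is already final in iterate [m.+1]. *)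
pose x s : 'M[fps R]_(p, q) :=
  \matrix_(i, j) FPS (fun m => fps_coef (it m.+1 s i j) m).
have xit k s : mx_eqmod k (x s) (it k s).
  move=> i j m lt_mk; rewrite mxE /= -(subnK lt_mk).
  exact: (itD m.+1 (k - m.+1)%N s i j m (ltnSn m)).
exists x => s; apply: mx_eqmod_eq => k; apply: (@mx_eqmodW _ k.+1) => //.
apply: mx_eqmod_trans (mx_eqmod_sym (xit k.+1 s)).
by apply: PhiC => s'; apply: xit.
Qed.

End Contraction.

(** A left inverse is a solution of [B = 1 + t B A], which is contracting; the index type [unit]
    makes it a system with one unknown. *)
Lemma inv_sub1X (R : comNzRingType) (p : nat) (A : 'M[fps R]_p) :
  exists B : 'M[fps R]_p, B *m (1%:M - fpsX R *: A) = 1%:M.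
Proof.
pose Phi (x : unit -> 'M[fps R]_p) s := 1%:M + fpsX R *: (x s *m A).
have [|x Ex] := @contraction_fixpoint _ _ _ _ Phi.
  move=> k x y xy s; apply: mx_eqmodD => //; apply: mx_eqmodX.
  by apply: mx_eqmodM.
exists (x tt); rewrite mulmxBr mulmx1 -scalemxAr -[X in X - _](Ex tt).
by rewrite /Phi addrK.
Qed.

(** * Derivations of determinants and of power series *)

Section Derivation.

Variables (R : comNzRingType) (d : R -> R).
Hypothesis dder : derivation d.

Lemma derivationB : {morph d : x y / x - y}.
Proof. by case: dder. Qed.

Lemma derivationM x y : d (x * y) = d x * y + x * d y.
Proof. by case: dder => _; apply. Qed.

Lemma derivation0 : d 0 = 0.
Proof. by rewrite -[X in d X](subrr 0) derivationB subrr. Qed.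

Lemma derivationN : {morph d : x / - x}.
Proof. by move=> x; rewrite -sub0r derivationB derivation0 sub0r. Qed.

Lemma derivationD : {morph d : x y / x + y}.
Proof. by move=> x y; rewrite -{1}[y]opprK derivationB derivationN opprK. Qed.

Lemma derivation1 : d 1 = 0.
Proof.
by apply: (addrI (d 1)); rewrite addr0 -{3}(mulr1 1) derivationM mulr1 mul1r.
Qed.

Lemma derivation_sum (I : Type) (r : seq I) (P : pred I) (f : I -> R) :
  d (\sum_(i <- r | P i) f i) = \sum_(i <- r | P i) d (f i).
Proof. exact: (big_morph d derivationD derivation0). Qed.

Lemma derivation_sign (b : bool) x : d ((-1) ^+ b * x) = (-1) ^+ b * d x.
Proof. by rewrite !mulr_sign; case: b => //; rewrite derivationN. Qed.

Lemma derivationX x k : d (x ^+ k) = k%:R * x ^+ k.-1 * d x.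
Proof.
elim: k => [|k IHk]; first by rewrite derivation1 !mul0r.
rewrite exprS derivationM IHk -natr1; case: k {IHk} => [|k] /=; first by ring.
by rewrite exprS; ring.
Qed.

Lemma derivation_prod_seq (I : eqType) (r : seq I) (f : I -> R) : uniq r ->
  d (\prod_(i <- r) f i) =
  \sum_(i <- r) d (f i) * \prod_(j <- r | j != i) f j.
Proof.
elim: r => [|i r IHr] /=; first by rewrite !big_nil derivation1.
case/andP=> nir ur; rewrite !big_cons derivationM IHr // eqxx /=; congr (_ + _).
  congr (_ * _); rewrite big_seq [RHS]big_seq_cond; apply: eq_bigl => j.
  by case: (boolP (j \in r)) => //= jr; rewrite (memPn nir).
rewrite mulr_sumr !big_seq; apply: eq_bigr => j jr.
by rewrite big_cons (memPnC nir _ jr) mulrCA.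
Qed.

Lemma derivation_prod (I : finType) (f : I -> R) :
  d (\prod_i f i) = \sum_i d (f i) * \prod_(j | j != i) f j.
Proof. exact: derivation_prod_seq (index_enum_uniq I). Qed.

Lemma derivation_mxD p q (A B : 'M_(p, q)) :
  map_mx d (A + B) = map_mx d A + map_mx d B.
Proof. by apply/matrixP => i j; rewrite !mxE derivationD. Qed.

Lemma derivation_mxB p q (A B : 'M_(p, q)) :
  map_mx d (A - B) = map_mx d A - map_mx d B.
Proof. by apply/matrixP => i j; rewrite !mxE derivationB. Qed.

Lemma derivation_mx_sum p q (I : Type) (r : seq I) (P : pred I) (A : I -> 'M_(p, q)) :
  map_mx d (\sum_(i <- r | P i) A i) = \sum_(i <- r | P i) map_mx d (A i).
Proof.
apply: (big_morph (map_mx d)); first exact: derivation_mxD.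
by apply/matrixP => i j; rewrite !mxE derivation0.
Qed.

Lemma derivation_mxM p q r (A : 'M_(p, q)) (B : 'M_(q, r)) :
  map_mx d (A *m B) = map_mx d A *m B + A *m map_mx d B.
Proof.
apply/matrixP => i j; rewrite !mxE derivation_sum -big_split /=.
by apply: eq_bigr => k _; rewrite !mxE derivationM.
Qed.

Lemma derivation_mx1 p : map_mx d (1%:M : 'M_p) = 0.
Proof.
apply/matrixP => i j; rewrite !mxE; case: eqP => _; first exact: derivation1.
exact: derivation0.
Qed.

Lemma derivation_mx_inv p (A B : 'M_p) :
  B *m A = 1%:M -> map_mx d B = - (B *m map_mx d A *m B).
Proof.
move=> BA; have := congr1 (fun M => map_mx d M *m B) BA.
rewrite derivation_mxM derivation_mx1 mul0mx mulmxDl -mulmxA (mulmx1C BA) mulmx1.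
by move/eqP; rewrite addr_eq0 => /eqP.
Qed.

(** Jacobi's formula. Differentiating one row at a time gives a sum of determinants, each of which
    is expanded along its differentiated row. *)
Lemma derivation_det p (A : 'M_p) : d (\det A) = \tr (\adj A *m map_mx d A).
Proof.
pose B i : 'M_p := \matrix_(k, j) if k == i then d (A k j) else A k j.
have -> : d (\det A) = \sum_i \det (B i).
  rewrite /determinant derivation_sum exchange_big /=; apply: eq_bigr => s _.
  rewrite derivation_sign derivation_prod mulr_sumr; apply: eq_bigr => i _.
  congr (_ * _); rewrite [RHS](bigD1 i) //= !mxE eqxx; congr (_ * _).
  by apply: eq_bigr => j /negbTE ne; rewrite mxE ne.
rewrite /mxtrace [RHS](eq_bigr (fun k => \sum_i d (A i k) * cofactor A i k)).
  rewrite [RHS]exchange_big /=; apply: eq_bigr => i _.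
  rewrite (expand_det_row _ i); apply: eq_bigr => j _; rewrite !mxE eqxx.
  congr (_ * (_ * \det _)); apply/matrixP => k l; rewrite !mxE.
  by rewrite eq_sym (negbTE (neq_lift _ _)).
by move=> k _; rewrite mxE; apply: eq_bigr => i _; rewrite !mxE mulrC.
Qed.

Lemma derivation_det_inv p (A B : 'M_p) : B *m A = 1%:M ->
  d (\det A) = \tr (B *m map_mx d A) * \det A.
Proof.
move=> BA; rewrite derivation_det.
have -> : \adj A = \det A *: B.
  by rewrite -[LHS]mul1mx -BA -mulmxA mul_mx_adj mul_mx_scalar.
by rewrite -scalemxAl mxtraceZ mulrC.
Qed.

Lemma derivation_det0 p (A : 'M_p) : map_mx d A = 0 -> d (\det A) = 0.
Proof. by move=> dA; rewrite derivation_det dA mulmx0 linear0. Qed.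

(** [u i] is the logarithmic derivative of [f i]; the relation is written as a product so that no
    division occurs. *)
Lemma log_derivation_prod (I : Type) (r : seq I) (f u : I -> R) :
  (forall i, d (f i) = u i * f i) ->
  d (\prod_(i <- r) f i) = (\sum_(i <- r) u i) * \prod_(i <- r) f i.
Proof.
move=> df; elim: r => [|i r IHr]; first by rewrite !big_nil derivation1 mul0r.
by rewrite !big_cons derivationM IHr df; ring.
Qed.

Lemma log_derivationX x u k : d x = u * x -> d (x ^+ k) = k%:R * u * x ^+ k.
Proof.
move=> dx; rewrite derivationX dx; case: k => [|k]; first by ring.
by rewrite exprS /=; ring.
Qed.

End Derivation.

(** * The Euler operator and the exponential *)

Section Theta.

Variable F : numFieldType.
Implicit Types f g h : fps F.

(** The operator t d/dt. *)
Definition fps_theta f : fps F := FPS (fun k => k%:R * fps_coef f k).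

Lemma fps_theta_derivation : derivation fps_theta.
Proof.
split=> [f g|f g]; apply: fpsP => k.
  by rewrite /= mulrBr.
rewrite fps_coef_add !fps_coefM /= mulr_sumr -big_split /=.
apply: eq_bigr => i _; rewrite -{1}(subnKC (leq_ord i)) natrD; ring.
Qed.

Lemma fps_thetaC c : fps_theta (fpsC c) = 0.
Proof.
apply: fpsP => -[|k]; rewrite /= coefC ?mul0r // mulr0 //.
Qed.

Lemma fps_thetaX : fps_theta (fpsX F) = fpsX F.
Proof. by apply: fpsP => k /=; rewrite coefX; case: eqP => [->|]; rewrite ?mulr1 ?mulr0. Qed.

(** Differentiating a partial sum of the exponential termwise gives the previous one times
    [fps_theta f]; in each degree finitely many terms matter because [f] has no constant term. *)
Lemma fps_theta_exp f : fps_coef f 0 = 0 ->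
  fps_theta (fps_exp f) = fps_theta f * fps_exp f.
Proof.
move=> f0; pose E N : fps F := \sum_(k < N) fpsC (k`!%:R^-1) * f ^+ k.
have expE N m : (m < N)%N -> fps_coef (fps_exp f) m = fps_coef (E N) m.
  move=> lt_mN; rewrite (fps_coef_exp f0 lt_mN) fps_coef_sum.
  by apply: eq_bigr => k _; rewrite fps_coefCM mulrC.
have thetaE N : fps_theta (E N.+1) = fps_theta f * E N.
  have th := fps_theta_derivation.
  rewrite /E (derivation_sum th) big_ord_recl (derivationM th) fps_thetaC mul0r.
  rewrite expr0 (derivation1 th) mulr0 !add0r mulr_sumr; apply: eq_bigr => k _.
  rewrite (derivationM th) fps_thetaC mul0r add0r (derivationX th) /bump /= /=.
  rewrite [RHS]mulrCA -!mulrA [fps_theta f * _]mulrC !mulrA; congr (_ * _ * _).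
  rewrite -(rmorph_nat (fpsC (R := F))) -rmorphM /=; congr fpsC.
  by rewrite factS natrM invfM mulrAC mulVf ?mul1r // pnatr_eq0.
apply: fpsP => m; have lt_m : (m < m.+2)%N by rewrite ltnS leqnSn.
transitivity (fps_coef (fps_theta (E m.+2)) m); first by rewrite /= -expE.
rewrite thetaE !fps_coefM; apply: eq_bigr => i _; congr (_ * _).
by rewrite (expE m.+1) // ltnS leq_subr.
Qed.

Lemma fps_exp_ev0 f : fps_ev0 (fps_exp f) = 1.
Proof. by rewrite /fps_ev0 /= big_ord1 expr0 /= fact0 divr1. Qed.

(** As [w] has no constant term, the equation in degree [m.+1] expresses [m.+1] times the
    coefficient through lower ones, so the constant term 1 determines the series. *)
Lemma log_derivation_unique f g w :
    fps_theta f = w * f -> fps_theta g = w * g -> fps_ev0 f = 1 -> fps_ev0 g = 1 ->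
  f = g.
Proof.
move=> fw gw f1 g1.
have w0 : fps_coef w 0 = 0.
  have := congr1 (fun h => fps_coef h 0) fw; rewrite fps_coefM big_ord1 subn0.
  rewrite [fps_coef f 0]f1 mulr1 => <- /=.
  by rewrite mul0r.
apply: fpsP => m; elim/ltn_ind: m => -[_|m IHm]; first exact: etrans f1 (esym g1).
have m0 : m.+1%:R != 0 :> F by rewrite pnatr_eq0.
apply: (mulfI m0).
have := congr1 (fun h => fps_coef h m.+1) fw; have := congr1 (fun h => fps_coef h m.+1) gw.
rewrite /= => -> ->; rewrite big_ord_recl [RHS]big_ord_recl w0 !mul0r !add0r.
by apply: eq_bigr => i _; rewrite IHm // /bump /= subSS ltnS leq_subr.
Qed.

End Theta.

Lemma fraction_fps_natr_neq0 (F : numFieldType) (k : nat) :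
  k.+1%:R != 0 :> {fraction fps F}.
Proof.
rewrite -(rmorph_nat (@tofrac (fps F))) -(rmorph_nat (@fpsC F)) tofrac_eq0.
by apply/eqP => /(congr1 (fun f => fps_coef f 0))/eqP; rewrite /= coefC pnatr_eq0.
Qed.

(** * The tree system *)

Section TreeSystem.

Variables (R : comNzRingType) (n p : nat).
Variables (A0 : 'M[R]_p) (A D : letter n -> 'M[R]_p).

(* Walks that leave the root through the edge v and come back to it once. *)
Definition tree_loop (v : letter n) : 'M[R]_p :=
  A v *m D (letter_inv v) *m A (letter_inv v).

(** In the tree reading, the inverse of this matrix sums all closed walks at the root. *)
Definition tree_root : 'M[R]_p := 1%:M - (A0 + \sum_v tree_loop v).

(** The edge [s] is barred: [D s], the inverse of this matrix, sums the closed walks at a vertex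
    that never cross its edge [s]. *)
Definition tree_cone (s : letter n) : 'M[R]_p :=
  1%:M - (A0 + \sum_(v | v != s) tree_loop v).

Lemma tree_coneE s : tree_cone s = tree_root + tree_loop s.
Proof.
rewrite /tree_cone /tree_root [in RHS](bigD1 s) //=.
by rewrite [tree_loop s + _]addrC (addrA A0) [in RHS]opprD (addrA 1%:M) subrK.
Qed.

Variable G : 'M[R]_p.
Hypothesis DK : forall s, D s *m tree_cone s = 1%:M.
Hypothesis GH : G *m tree_root = 1%:M.

Lemma tree_cone_mul s : tree_cone s *m D s = 1%:M.
Proof. exact: mulmx1C. Qed.

Lemma tree_root_mul : tree_root *m G = 1%:M.
Proof. exact: mulmx1C. Qed.

(** Both sides sum the walks from the vertex [letter_inv s] to the root: the left side cuts them at
    the first crossing of the edge joining the two, the right side at the last crossing. *)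
Lemma tree_root_exchange s :
  D (letter_inv s) *m A (letter_inv s) *m G = G *m A (letter_inv s) *m D s.
Proof.
set s' := letter_inv s.
have E : tree_root *m (D s' *m A s') = A s' *m D s *m tree_root.
  have E1 := tree_coneE s; have E2 := tree_coneE s'.
  have -> : tree_root *m (D s' *m A s') =
      tree_cone s' *m D s' *m A s' - tree_loop s' *m D s' *m A s'.
    by rewrite E2 !mulmxDl -!mulmxA addrK.
  have -> : A s' *m D s *m tree_root =
      A s' *m (D s *m tree_cone s) - A s' *m D s *m tree_loop s.
    by rewrite E1 !mulmxDr !mulmxA addrK.
  by rewrite DK tree_cone_mul mulmx1 mul1mx /tree_loop /s' letter_invK !mulmxA.
rewrite -[LHS]mul1mx -GH -!mulmxA [in LHS](mulmxA (D s')) (mulmxA tree_root) E.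
by rewrite -!mulmxA tree_root_mul mulmx1.
Qed.

(** A closed walk at the root either avoids the edge [s], or is cut at its first crossing of that
    edge and at its last return through it. *)
Lemma tree_resolvent_split s :
  G = D s + D s *m A s *m G *m A (letter_inv s) *m D s.
Proof.
have E : tree_cone s *m G = 1%:M + A s *m G *m A (letter_inv s) *m D s.
  rewrite tree_coneE mulmxDl tree_root_mul; congr (_ + _).
  by rewrite /tree_loop -!mulmxA (mulmxA (D (letter_inv s))) tree_root_exchange !mulmxA.
rewrite -[LHS]mul1mx -(DK s) -mulmxA E mulmxDr mulmx1.
by rewrite !mulmxA.
Qed.

(* The coefficient of the reduced word w in the resolvent of A0 + \sum_v A v * v:
   a walk from w to 1 is cut at its first visits to the suffixes of w. *)
Fixpoint tree_resolvent (w : seq (letter n)) : 'M[R]_p :=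
  if w is s :: w' then D s *m A s *m tree_resolvent w' else G.

(** First-step equation of the resolvent. From [x :: w], the letter [x] shortens the word, and every
    other letter opens a loop that must come back. *)
Lemma tree_resolventE w :
  tree_resolvent w = (w == [::])%:R%:M + A0 *m tree_resolvent w
    + \sum_s A s *m tree_resolvent (cons_red (letter_inv s) w).
Proof.
case: w => [|x w].
  rewrite /= (eq_bigr (fun s => tree_loop s *m G)) => [|s _]; last by rewrite !mulmxA.
  rewrite -mulmx_suml -addrA -mulmxDl -tree_root_mul /tree_root -mulmxDl subrK.
  by rewrite mul1mx.
rewrite raddf0 add0r (bigD1 x) //= letter_invK eqxx.
rewrite (eq_bigr (fun s => tree_loop s *m tree_resolvent (x :: w))) => [|s sx].
  rewrite -mulmx_suml addrCA addrC -mulmxDl.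
  have <- : tree_cone x *m tree_resolvent (x :: w) = A x *m tree_resolvent w.
    by rewrite /= !mulmxA tree_cone_mul mul1mx.
  by rewrite -mulmxDl addrC subrK mul1mx.
by rewrite letter_invK eq_sym (negbTE sx) /= !mulmxA.
Qed.

(** The hypotheses on [d] are those of t d/dt, which fixes [A = t B]. This is the determinant
    formula after logarithmic differentiation, with [G - 1] standing for the series of traces. *)
Lemma tree_log_derivation (d : R -> R) : derivation d ->
    map_mx d A0 = A0 -> (forall s, map_mx d (A s) = A s) ->
  \sum_s \tr (D s *m map_mx d (tree_cone s)) + 2%:R * \tr (G *m map_mx d tree_root)
  = - 2%:R * \tr (G - 1%:M) + #|{: letter n}|%:R * \tr (G *m map_mx d tree_root).
Proof.
move=> dder dA0 dA.
pose X s := \tr (G *m map_mx d (tree_loop s)).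
have E1 s : \tr (D s *m map_mx d (tree_cone s)) =
    X (letter_inv s) - 2%:R * \tr (G *m tree_loop (letter_inv s))
    + \tr (G *m map_mx d tree_root) + X s.
  (* Leibniz rule on [A (letter_inv s) D s A s]: the outer factors are fixed by [d] and give the
     factor 2; the middle one gives [- D s K D s], which cyclicity of the trace and the splitting of
     [G] turn into [G - D s] times [K]. *)
  have EX : X (letter_inv s) = 2%:R * \tr (G *m tree_loop (letter_inv s))
      - \tr ((G - D s) *m map_mx d (tree_cone s)).
    rewrite /X /tree_loop letter_invK !(derivation_mxM dder) !dA.
    rewrite (derivation_mx_inv dder (DK s)).
    set a := A _; set a' := A s; set K := map_mx d _.
    have -> : G - D s = D s *m a' *m G *m a *m D s.
      by rewrite {1}(tree_resolvent_split s) addrAC subrr add0r.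
    rewrite mulmxN mulmxBl mulmxDr mulmxBr linearD linearB /=.
    have -> : \tr (G *m (a *m (D s *m K *m D s) *m a')) = \tr (D s *m a' *m G *m a *m D s *m K).
      have -> : G *m (a *m (D s *m K *m D s) *m a') = G *m a *m D s *m K *m (D s *m a').
        by rewrite !mulmxA.
      by rewrite mxtrace_mulC !mulmxA.
    ring.
  rewrite EX mulmxBl linearB /= {2}tree_coneE (derivation_mxD dder) mulmxDr linearD /=.
  by rewrite -/(X s); ring.
rewrite (eq_bigr _ (fun s _ => E1 s)) !big_split /=.
have inv_sum (f : letter n -> R) : \sum_s f (letter_inv s) = \sum_s f s.
  by rewrite [RHS](reindex_inj (can_inj (@letter_invK n))).
rewrite inv_sum sumrN -mulr_sumr (inv_sum (fun s => \tr (G *m tree_loop s))).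
rewrite sumr_const -mulr_natl.
(* The loops add up to [1 - A0 - tree_root], and [d] fixes [A0]. *)
have -> : \sum_s X s = - \tr (G *m A0) - \tr (G *m map_mx d tree_root).
  rewrite /tree_root (derivation_mxB dder) (derivation_mx1 dder) (derivation_mxD dder).
  rewrite dA0 (derivation_mx_sum dder) sub0r mulmxN linearN /= opprK mulmxDr linearD /=.
  by rewrite addrA addNr add0r mulmx_sumr linear_sum.
have -> : \tr (G - 1%:M) = \tr (G *m A0) + \sum_s \tr (G *m tree_loop s).
  rewrite -linear_sum -mulmx_sumr -linearD -mulmxDr -{1}[G]mulmx1 -[X in _ - X]GH -mulmxBr.
  by congr (\tr (G *m _)); rewrite /tree_root opprB [LHS]addrC subrK.
set t := \tr _; set u := \tr _; set v := \sum_s _; 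
set k := (_%:R : R); ring.
Qed.

End TreeSystem.

(** * Elements linear in the letters *)

Section GroupRingCoefficients.

Variables (R : nzRingType) (G : groupType).
Implicit Types a b c : group_ring R G.

Lemma gr_coef_elt r x y : (gr_elt r x : group_ring R G)@_y = r *+ (x == y).
Proof. exact: mcoeffU. Qed.

Lemma gr_coefD a b y : (a + b)@_y = a@_y + b@_y.
Proof. exact: mcoeffD. Qed.

Lemma gr_coef_sum (I : Type) (r : seq I) (P : pred I) (f : I -> group_ring R G) y :
  (\sum_(i <- r | P i) f i)@_y = \sum_(i <- r | P i) (f i)@_y.
Proof.
apply: (big_morph (fun c : group_ring R G => c@_y)); first by move=> a b; apply: gr_coefD.
exact: mcoeff0.
Qed.

Lemma gr_coef_eltM r x a y : (gr_elt r x * a)@_y = r * a@_(x^-1 * y)%g.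
Proof.
rewrite (gr_sum a) -[_ * _]/(gr_mul _ _) gr_mul_sumr !gr_coef_sum mulr_sumr.
apply: eq_bigr => z _; rewrite gr_mul_elt !gr_coef_elt mulrnAr.
by congr (_ *+ nat_of_bool _); apply/eqP/eqP => [<-|->]; rewrite ?mulKg ?mulVKg.
Qed.

Lemma gr_coef1 y : (1 : group_ring R G)@_y = 1 *+ (1%g == y).
Proof. exact: gr_coef_elt. Qed.

End GroupRingCoefficients.

Definition fg_letter n (s : letter n) : free_group n := @FreeGroup n [:: s] isT.

Section LinearElement.

Variables (R : nzRingType) (n : nat) (b0 : R) (b : letter n -> R).

Definition gr_linear : group_ring R (free_group n) :=
  gr_elt b0 1%g + \sum_s gr_elt (b s) (fg_letter s).

Lemma gr_linear_coefM c (g : free_group n) :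
  (gr_linear * c)@_g = b0 * c@_g + \sum_s b s * c@_((fg_letter s)^-1 * g)%g.
Proof.
rewrite mulrDl gr_coefD.
congr (_ + _); first by apply: etrans (gr_coef_eltM _ _ _ _) _; rewrite invg1 mul1g.
rewrite mulr_suml gr_coef_sum; apply: eq_bigr => s _.
by rewrite gr_coef_eltM.
Qed.

End LinearElement.

Section LinearSystem.

Variables (F : numFieldType) (n p : nat).
Variables (B0 : 'M[F]_p.+1) (B : letter n -> 'M[F]_p.+1).

Local Notation fpsmx := 'M[fps F]_p.+1.

Definition fps_mx (M : 'M[F]_p.+1) : fpsmx := fpsX F *: map_mx (@fpsC F) M.

Lemma fps_mx_coefM (M : 'M[F]_p.+1) (N : fpsmx) i j m :
  fps_coef ((fps_mx M *m N) i j) m =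
  if m is k.+1 then \sum_l M i l * fps_coef (N l j) k else 0.
Proof.
rewrite -scalemxAl mxE fps_coefXM; case: m => // m.
rewrite mxE fps_coef_sum; apply: eq_bigr => l _.
by rewrite mxE fps_coefCM.
Qed.

Local Notation A0 := (fps_mx B0).
Local Notation A := (fun s => fps_mx (B s)).

(** Since every [A v] carries a factor [t], the system takes the form [D s = 1 + t D s (step D s)],
    which is contracting. *)
Lemma tree_system_solvable : exists D : letter n -> fpsmx,
  forall s, D s *m tree_cone A0 A D s = 1%:M.
Proof.
pose b s : fpsmx := map_mx (@fpsC F) (B s).
pose step (D : letter n -> fpsmx) s := map_mx (@fpsC F) B0 +
  \sum_(v | v != s) b v *m D (letter_inv v) *m A (letter_inv v).
pose Phi D s := 1%:M + fpsX F *: (D s *m step D s).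
have [|D ED] := @contraction_fixpoint _ _ _ _ Phi.
  move=> k x y xy s; rewrite /Phi /step; apply: (mx_eqmodD (mx_eqmod_refl _)); apply: mx_eqmodX.
  apply: mx_eqmodM (xy s) _; apply: (mx_eqmodD (mx_eqmod_refl _)).
  apply: mx_eqmod_sum => v; apply: mx_eqmodM (mx_eqmod_refl _).
  exact: mx_eqmodM (mx_eqmod_refl _) (xy _).
exists D => s.
have -> : tree_cone A0 A D s = 1%:M - fpsX F *: step D s.
  rewrite /tree_cone /step scalerDr scaler_sumr; congr (_ - (_ + _)).
  by apply: eq_bigr => v _; rewrite /tree_loop /fps_mx -!scalemxAl.
by rewrite mulmxBr mulmx1 -scalemxAr -[X in X - _]ED addrK.
Qed.

Variables (D : letter n -> fpsmx) (G : fpsmx).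
Hypothesis DK : forall s, D s *m tree_cone A0 A D s = 1%:M.
Hypothesis GH : G *m tree_root A0 A D = 1%:M.

(** Multiplication by the linear element and [tree_resolventE] give the same recursion in [m]; the
    factor [t] in [A0] and [A] lowers the degree by one. *)
Lemma tree_resolvent_coef m (g : free_group n) i j :
  (gr_linear B0 B ^+ m)@_g i j = fps_coef (tree_resolvent A D G (word_of g) i j) m.
Proof.
elim: m g i j => [|m IHm] g i j.
  rewrite expr0 gr_coef1 (tree_resolventE DK GH) 2!mxE 2!fps_coef_add.
  rewrite fps_mx_coefM addr0 [X in _ + X](_ : _ = 0) ?addr0.
    rewrite eq_sym mxE -[word_of g == [::]]/(g == 1%g).
    case: eqP => _; rewrite ?mulr0n ?mul0rn mxE; last by case: (i == j).
    by case: eqP.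
  rewrite summxE fps_coef_sum big1 // => s _; exact: fps_mx_coefM.
rewrite exprS gr_linear_coefM (tree_resolventE DK GH) [LHS]mxE.
rewrite 2![in RHS]mxE 2!fps_coef_add fps_mx_coefM [X in _ = X + _ + _](_ : _ = 0) ?add0r.
  rewrite [X in X + _ = _]mxE; congr (_ + _).
    by apply: eq_bigr => l _; rewrite IHm.
  rewrite !summxE fps_coef_sum; apply: eq_bigr => s _.
  rewrite fps_mx_coefM mxE; apply: eq_bigr => l _; rewrite IHm.
  by congr (_ * fps_coef (tree_resolvent _ _ _ _ _ _) _).
by rewrite mxE; case: (_ == _); case: (_ == _).
Qed.

Lemma tree_root_series i j :
  G i j = FPS (fun m => (gr_linear B0 B ^+ m)@_1%g i j).
Proof. by apply: fpsP => m /=; rewrite tree_resolvent_coef. Qed.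

End LinearSystem.

(** * The determinant formula and its consequences for derivations *)

Section LinearDeterminant.

Variables (F : numFieldType) (n p : nat).
Variables (B0 : 'M[F]_p.+1) (B : letter n -> 'M[F]_p.+1).

Local Notation A0 := (fps_mx B0).
Local Notation A := (fun s => fps_mx (B s)).

Definition mx_trace_series (b : group_ring 'M[F]_p.+1 (free_group n)) : fps F :=
  FPS (fun k => if k == 0%N then 0 else \tr ((b ^+ k)@_1%g) / k%:R).

Local Notation P := (fps_exp (- mx_trace_series (gr_linear B0 B))).

Lemma fps_theta_mx (M : 'M[F]_p.+1) : map_mx (@fps_theta F) (fps_mx M) = fps_mx M.
Proof.
apply/matrixP => i j; rewrite !mxE (derivationM (@fps_theta_derivation F)).
by rewrite fps_thetaC fps_thetaX mulr0 addr0.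
Qed.

Lemma fps_ev0_mx (M : 'M[F]_p.+1) : map_mx (@fps_ev0 F) (fps_mx M) = 0.
Proof. by apply/matrixP => i j; rewrite !mxE /fps_ev0 fps_coefXM. Qed.

Section Solution.

Variables (D : letter n -> 'M[fps F]_p.+1) (G : 'M[fps F]_p.+1).
Hypothesis DK : forall s, D s *m tree_cone A0 A D s = 1%:M.
Hypothesis GH : G *m tree_root A0 A D = 1%:M.

Lemma fps_ev0_tree (r : seq (letter n)) (Q : pred (letter n)) :
  fps_ev0 (\det (1%:M - (A0 + \sum_(v <- r | Q v) tree_loop A D v))) = 1.
Proof.
rewrite -det_map_mx map_mxB map_mx1 map_mxD fps_ev0_mx add0r raddf_sum big1.
  by rewrite subr0 det1.
by move=> v _; rewrite /= /tree_loop !map_mxM fps_ev0_mx !mul0mx.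
Qed.

(** Both sides have constant term 1 and the same logarithmic derivative for the Euler operator. The
    powers are arranged to avoid inverses; [#|{: letter n}|] is 2n. *)
Lemma linear_det_formula :
  P ^+ 2 * \det (tree_root A0 A D) ^+ #|{: letter n}| =
  (\prod_s \det (tree_cone A0 A D s)) * \det (tree_root A0 A D) ^+ 2.
Proof.
have th := @fps_theta_derivation F.
set H := tree_root _ _ _.
have trG k : fps_coef (\tr (G - 1%:M)) k =
    if k == 0%N then 0 else \tr ((gr_linear B0 B ^+ k)@_1%g).
  have E i : fps_coef ((G - 1%:M) i i) k =
      (gr_linear B0 B ^+ k)@_1%g i i - (k == 0%N)%:R.
    by rewrite !mxE fps_coef_add fps_coef_opp eqxx (tree_root_series DK GH).
  rewrite /mxtrace fps_coef_sum (eq_bigr _ (fun i _ => E i)).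
  case: k {E} => [|k] /=; last by apply: eq_bigr => i _; rewrite subr0.
  by rewrite big1 // => i _; rewrite expr0 gr_coef1 eqxx mxE eqxx subrr.
(* The Euler operator cancels the denominators [k] of the trace series and leaves the trace of
   [G - 1]. *)
have dP : fps_theta P = - \tr (G - 1%:M) * P.
  rewrite fps_theta_exp /= ?oppr0 //; congr (_ * _); apply: fpsP => k.
  rewrite fps_coef_opp trG /=; case: eqP => [_|/eqP k0]; first by rewrite oppr0 mulr0.
  by rewrite mulrN mulrC divfK // pnatr_eq0.
have dH : fps_theta (\det H) = \tr (G *m map_mx (@fps_theta F) H) * \det H.
  exact: (derivation_det_inv th GH).
have dK s : fps_theta (\det (tree_cone A0 A D s)) =
    \tr (D s *m map_mx (@fps_theta F) (tree_cone A0 A D s)) * \det (tree_cone A0 A D s).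
  exact: (derivation_det_inv th (DK s)).
have := tree_log_derivation DK GH th (fps_theta_mx B0) (fun s => fps_theta_mx (B s)).
rewrite -/H; set u := \sum_s _; set w := \tr (G *m map_mx _ H).
set v := \tr _ => E.
have ringE (K : comNzRingType) (a b c e f : K) :
  2%:R * - f * b * c + b * (a * e * c) = (- 2%:R * f + a * e) * (b * c) by ring.
have ringE' (K : comNzRingType) (a b c e : K) :
  a * b * c + b * (2%:R * e * c) = (a + 2%:R * e) * (b * c) by ring.
(* This is the logarithmic derivative of the right-hand side; [E] identifies it with that of the
   left. *)
apply: (@log_derivation_unique _ _ _ (u + 2%:R * w)).
- rewrite (derivationM th) (log_derivationX th _ dP) (log_derivationX th _ dH) E.
  exact: ringE.
- rewrite (derivationM th) (log_derivation_prod th _ dK) (log_derivationX th _ dH).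
  exact: ringE'.
- rewrite rmorphM !rmorphXn /= fps_exp_ev0 fps_ev0_tree. by rewrite !expr1n mulr1.
- rewrite rmorphM rmorphXn /= [X in _ * X ^+ _]fps_ev0_tree expr1n mulr1.
  by rewrite rmorph_prod big1 // => s _; apply: fps_ev0_tree.
Qed.

Variable d : {fraction fps F} -> {fraction fps F}.
Hypothesis dder : derivation d.
Hypothesis dC : forall c, d (tofrac (fpsC c)) = 0.
Hypothesis dX : d (tofrac (fpsX F)) = 0.

Local Notation frac_mx M := (map_mx (@tofrac (fps F)) M).

Lemma derivation_fps_mx (M : 'M[F]_p.+1) : map_mx d (frac_mx (fps_mx M)) = 0.
Proof.
apply/matrixP => i j; rewrite !mxE rmorphM (derivationM dder) dC dX.
by rewrite mulr0 mul0r addr0.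
Qed.

Lemma derivation_tree_loop v : map_mx d (frac_mx (tree_loop A D v)) =
  frac_mx (A v) *m map_mx d (frac_mx (D (letter_inv v))) *m frac_mx (A (letter_inv v)).
Proof.
rewrite /tree_loop map_mxM (derivation_mxM dder) (derivation_fps_mx (B (letter_inv v))).
rewrite map_mxM (derivation_mxM dder) (derivation_fps_mx (B v)).
by rewrite mul0mx mulmx0 addr0 add0r.
Qed.

Lemma derivation_tree_sum (r : seq (letter n)) (Q : pred (letter n)) :
  map_mx d (frac_mx (1%:M - (A0 + \sum_(v <- r | Q v) tree_loop A D v))) =
  - \sum_(v <- r | Q v) map_mx d (frac_mx (tree_loop A D v)).
Proof.
rewrite map_mxB map_mxD map_mx1 (derivation_mxB dder) (derivation_mxD dder).
rewrite (derivation_mx1 dder) derivation_fps_mx raddf_sum (derivation_mx_sum dder).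
by rewrite !add0r.
Qed.

(** The derivatives of the [D s] solve a homogeneous linear system. After multiplication by a common
    denominator they are power series; the factors [t] in [A] make the system contracting, so they
    coincide with the zero solution. *)
Lemma derivation_tree_branch s : map_mx d (frac_mx (D s)) = 0.
Proof.
pose x (s : letter n) := map_mx d (frac_mx (D s)).
have [q q0 [y Ey]] := fraction_common_denom
  (fun i : letter n * ('I_p.+1 * 'I_p.+1) => x i.1 i.2.1 i.2.2).
pose Y s : 'M[fps F]_p.+1 := \matrix_(i, j) y (s, (i, j)).
have EY t : frac_mx (Y t) = tofrac q *: x t.
  by apply/matrixP => i j; rewrite !mxE -Ey /= !mxE.
have tofrac_inj : injective (@tofrac (fps F)).
  by move=> a b /eqP; rewrite tofrac_eq => /eqP.
(* The differentiated system: the derivative of [D] is [- D (dK) D], and in each loop [d] kills the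
   outer factors and acts on the inner [D] alone. *)
pose Phi (Z : letter n -> 'M[fps F]_p.+1) t :=
  D t *m (\sum_(v | v != t) A v *m Z (letter_inv v) *m A (letter_inv v)) *m D t.
have PhiY t : Phi Y t = Y t.
  apply/matrixP => i j; apply: tofrac_inj.
  suff /matrixP/(_ i j) : frac_mx (Phi Y t) = frac_mx (Y t) by rewrite !mxE.
  rewrite EY.
  have -> : x t = frac_mx (D t) *m
      (\sum_(v | v != t) frac_mx (A v) *m x (letter_inv v) *m frac_mx (A (letter_inv v)))
      *m frac_mx (D t).
    have E : frac_mx (D t) *m frac_mx (tree_cone A0 A D t) = 1%:M.
      by rewrite -map_mxM DK map_mx1.
    rewrite {1}/x (derivation_mx_inv dder E).
    rewrite /tree_cone derivation_tree_sum mulmxN mulNmx opprK.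
    by rewrite (eq_bigr _ (fun v _ => derivation_tree_loop v)).
  rewrite /Phi !map_mxM raddf_sum /= scalemxAl scalemxAr scaler_sumr.
  congr (_ *m _ *m _); apply: eq_bigr => v _.
  by rewrite !map_mxM EY -scalemxAr -scalemxAl.
have Phi0 t : Phi (fun=> 0) t = 0.
  by rewrite /Phi big1 ?mulmx0 ?mul0mx // => v _; rewrite mulmx0 mul0mx.
have PhiC k z w : (forall t, mx_eqmod k (z t) (w t)) ->
    forall t, mx_eqmod k.+1 (Phi z t) (Phi w t).
  move=> zw t; apply: mx_eqmodM (mx_eqmod_refl _).
  apply: (mx_eqmodM (mx_eqmod_refl _)).
  apply: mx_eqmod_sum => v; rewrite /fps_mx -!scalemxAr; apply: mx_eqmodX.
  apply: mx_eqmodM (mx_eqmod_refl _); apply: (mx_eqmodM (mx_eqmod_refl _)).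
  exact: zw.
have Y0 : Y s = 0 by apply: (contraction_unique PhiC PhiY Phi0).
have := EY s; rewrite Y0 map_mx0 => /esym/eqP.
by rewrite scaler_eq0 tofrac_eq0 (negbTE q0) => /eqP.
Qed.

(** [d] kills every determinant in [linear_det_formula], which leaves [2 P (d P)] times a nonzero
    factor equal to 0. *)
Lemma derivation_linear_det_aux : d (tofrac P) = 0.
Proof.
pose k := tofrac (\prod_s \det (tree_cone A0 A D s)).
pose h := tofrac (\det (tree_root A0 A D)).
have loop0 v : map_mx d (frac_mx (tree_loop A D v)) = 0.
  by rewrite derivation_tree_loop derivation_tree_branch mulmx0 mul0mx.
have det0 (r : seq (letter n)) (Q : pred (letter n)) :
    d (tofrac (\det (1%:M - (A0 + \sum_(v <- r | Q v) tree_loop A D v)))) = 0.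
  rewrite -det_map_mx; apply: (derivation_det0 dder).
  by rewrite derivation_tree_sum big1 ?oppr0.
have dh : d h = 0 * h by rewrite mul0r; apply: det0.
have dk : d k = 0.
  rewrite /k rmorph_prod (@log_derivation_prod _ _ dder _ _ _ (fun=> 0)).
    by rewrite big1 // mul0r.
  by move=> s; rewrite mul0r; apply: det0.
have dhX m : d (h ^+ m) = 0 by rewrite (log_derivationX dder m dh) mulr0 mul0r.
have nz (f : fps F) : fps_ev0 f = 1 -> tofrac f != 0.
  move=> f1; rewrite tofrac_eq0; apply/eqP => f0; move/eqP: f1.
  by rewrite f0 rmorph0 eq_sym oner_eq0.
have hn0 : h ^+ #|{: letter n}| != 0.
  by apply: expf_neq0; apply: nz; apply: fps_ev0_tree.
have Pn0 : tofrac P != 0 by apply: nz; apply: fps_exp_ev0.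
have cancel (L : idomainType) (c x y z : L) :
    c != 0 -> x != 0 -> z != 0 -> c * x * y * z = 0 -> y = 0.
  move=> /negbTE c0 /negbTE x0 /negbTE z0 /eqP.
  by rewrite !mulf_eq0 c0 x0 z0 orbF => /eqP.
have : d (tofrac P ^+ 2 * h ^+ #|{: letter n}|) = 0.
  rewrite -!rmorphXn -rmorphM linear_det_formula rmorphM rmorphXn.
  by rewrite (derivationM dder) -/k -/h dk dhX mul0r mulr0 addr0.
rewrite (derivationM dder) dhX mulr0 addr0 (derivationX dder).
exact: (cancel _ _ _ _ _ (fraction_fps_natr_neq0 F 1) Pn0 hn0).
Qed.

End Solution.

Theorem derivation_linear_det (d : {fraction fps F} -> {fraction fps F}) :
    derivation d -> (forall c, d (tofrac (fpsC c)) = 0) -> d (tofrac (fpsX F)) = 0 ->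
  d (tofrac P) = 0.
Proof.
have [D DK] := tree_system_solvable B0 B.
(* Chosen so that [tree_root] is [1 - t M]. *)
pose M := map_mx (@fpsC F) B0 +
  \sum_v map_mx (@fpsC F) (B v) *m D (letter_inv v) *m fps_mx (B (letter_inv v)).
have [G GM] := inv_sub1X M.
have GH : G *m tree_root A0 A D = 1%:M.
  rewrite -GM /tree_root /M scalerDr scaler_sumr.
  congr (_ *m (_ - (_ + _))); apply: eq_bigr => v _.
  by rewrite /tree_loop /fps_mx -!scalemxAl.
exact: (derivation_linear_det_aux DK GH).
Qed.

End LinearDeterminant.

(** * Linearization *)

Section CyclicTrace.

Variables (E : nzRingType) (V : zmodType) (T : E -> V) (l : nat).
Variables (e : nat -> E) (b : E).
Hypothesis TD : {morph T : x y / x + y}.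
Hypothesis T0 : T 0 = 0.
Hypothesis TC : forall x y, T (x * y) = T (y * x).
Hypothesis e1 : \sum_(i < l) e i = 1.
Hypothesis eid : forall i, e i * e i = e i.
Hypothesis e_orth : forall i j, i != j %[mod l] -> e i * e j = 0.
Hypothesis e_shift : forall i, e i * b = b * e i.+1.

Lemma cyclic_shift i m : e i * b ^+ m = b ^+ m * e (i + m)%N.
Proof.
elim: m i => [|m IHm] i; first by rewrite expr0 mulr1 mul1r addn0.
by rewrite exprS mulrA e_shift -mulrA IHm mulrA addSnnS.
Qed.

(** Carrying one factor [b] around the trace replaces [i] by [i.+1]; this uses up one factor, hence
    the positive exponent. *)
Lemma cyclic_trace_const i m : T (e i * b ^+ m.+1) = T (e 0%N * b ^+ m.+1).
Proof.
elim: i => // i <-; apply/esym.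
by rewrite {1}exprS mulrA e_shift -mulrA TC -mulrA -exprSr.
Qed.

(** The [e i] act as projections of a grading modulo [l] that [b] shifts by one. If [l] does not
    divide the exponent, [e i] meets its shifted idempotent around the trace and the product is 0;
    otherwise the [l] summands agree. *)
Lemma cyclic_trace m :
  T (b ^+ m.+1) = if (l %| m.+1)%N then T (e 0%N * b ^+ m.+1) *+ l else 0.
Proof.
have -> : T (b ^+ m.+1) = \sum_(i < l) T (e i * b ^+ m.+1).
  by rewrite -[in LHS](mul1r (b ^+ _)) -{1}e1 mulr_suml (big_morph T TD T0).
case: ifP => lm.
  rewrite -[l in RHS]card_ord -sumr_const; apply: eq_bigr => i _.
  exact: cyclic_trace_const.
rewrite big1 // => i _; rewrite -eid -mulrA cyclic_shift mulrA TC mulrA e_orth ?mul0r //.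
rewrite -{2}[nat_of_ord i]addn0 eqn_modDl mod0n.
by apply: contraFneq lm => /eqP.
Qed.

End CyclicTrace.

Section FreeGroupSegments.

Variable n : nat.
Implicit Types (u v w : seq (letter n)) (g : free_group n).

Lemma word_mul_cat u v : reduced (u ++ v) -> word_mul u v = u ++ v.
Proof.
elim: u => //= x u IHu ruv; rewrite IHu ?(reduced_behead ruv) //.
by case: (u ++ v) ruv => //= y w /andP[/negbTE -> _].
Qed.

Lemma fg_prefix_reduced m g : reduced (take m (word_of g)).
Proof. exact/take_sorted/word_of_reduced. Qed.

Lemma fg_segment_reduced m g : reduced (take 1 (drop m (word_of g))).
Proof. exact/take_sorted/drop_sorted/word_of_reduced. Qed.

Definition fg_prefix m g : free_group n := FreeGroup (fg_prefix_reduced m g).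

(** The letter of [g] at position [m], or 1 past the end; this is how words are padded to a common
    length. *)
Definition fg_segment m g : free_group n := FreeGroup (fg_segment_reduced m g).

Lemma fg_prefixS m g : fg_prefix m.+1 g = (fg_prefix m g * fg_segment m g)%g.
Proof.
apply: val_inj => /=; rewrite -addn1 takeD word_mul_cat // -takeD.
exact: fg_prefix_reduced.
Qed.

Lemma fg_prefix0 g : fg_prefix 0 g = 1%g.
Proof. by apply: val_inj; rewrite /= take0. Qed.

Lemma fg_prefix_size m g : (size (word_of g) <= m)%N -> fg_prefix m g = g.
Proof. by move=> le_m; apply: val_inj; rewrite /= take_oversize. Qed.

Lemma fg_size1 g : (size (word_of g) <= 1)%N -> g = 1%g \/ exists s, g = fg_letter s.
Proof.
case: g => -[|s [|]] //= rw _; [left|right; exists s]; exact: val_inj.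
Qed.

End FreeGroupSegments.

Section LinearSum.

Variables (R : nzRingType) (n : nat).

Lemma gr_linearD b0 b c0 c :
  gr_linear b0 b + gr_linear c0 c =
  gr_linear (b0 + c0) (fun s => b s + c s) :> group_ring R (free_group n).
Proof.
rewrite /gr_linear gr_eltD addrACA; congr (_ + _).
by rewrite -big_split; apply: eq_bigr => s _; rewrite gr_eltD.
Qed.

Lemma gr_linear_unit r : gr_linear r (fun=> 0) = gr_elt r 1%g :> group_ring R (free_group n).
Proof. by rewrite /gr_linear big1 ?addr0 // => s _; apply: gr_elt0. Qed.

Lemma gr_linear_letter r s :
  gr_linear 0 (fun t => if t == s then r else 0) =
  gr_elt r (fg_letter s) :> group_ring R (free_group n).
Proof.
rewrite /gr_linear gr_elt0 add0r (bigD1 s) //= eqxx big1 ?addr0 //.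
by move=> t /negbTE ->; apply: gr_elt0.
Qed.

Lemma gr_linear_sum (I : Type) (r : seq I) (f : I -> R) (x : I -> free_group n) :
    (forall i, size (word_of (x i)) <= 1)%N ->
  exists b0 b, \sum_(i <- r) gr_elt (f i) (x i) = gr_linear b0 b.
Proof.
move=> x1; elim: r => [|i r [b0 [b E]]].
  by exists 0, (fun=> 0); rewrite big_nil gr_linear_unit gr_elt0.
have [c0 [c Ec]] : exists c0 c, gr_elt (f i) (x i) = gr_linear c0 c.
  have [->|[s ->]] := fg_size1 (x1 i).
    by exists (f i), (fun=> 0); rewrite gr_linear_unit.
  by exists 0, (fun t => if t == s then f i else 0); rewrite gr_linear_letter.
exists (c0 + b0), (fun s => c s + b s).
by rewrite big_cons E Ec; apply: gr_linearD.
Qed.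

End LinearSum.

Section GroupRingTrace.

Variables (R : nzRingType) (G : groupType).

Lemma gr_eltM r s (x y : G) :
  gr_elt r x * gr_elt s y = gr_elt (r * s) (x * y)%g :> group_ring R G.
Proof. exact: gr_mul_elt. Qed.

Lemma gr_elt_sum (I : Type) (l : seq I) (P : pred I) (f : I -> R) (x : G) :
  gr_elt (\sum_(i <- l | P i) f i) x = \sum_(i <- l | P i) gr_elt (f i) x.
Proof.
by apply: (big_morph (fun r => gr_elt r x)) => [r s|]; [apply: gr_eltD | apply: gr_elt0].
Qed.

Lemma gr_sum_coef (I : Type) (l : seq I) (c : I -> R) (g : I -> G) x :
  (\sum_(j <- l) gr_elt (c j) (g j))@_x = \sum_(j <- l) c j *+ (g j == x).
Proof. by rewrite gr_coef_sum; apply: eq_bigr => j _; rewrite gr_coef_elt. Qed.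

Lemma gr_sum_coefM (I : Type) (l : seq I) (c : I -> R) (g : I -> G)
    (a : group_ring R G) x :
  ((\sum_(j <- l) gr_elt (c j) (g j)) * a)@_x =
  \sum_(j <- l) c j * a@_((g j)^-1 * x)%g.
Proof.
by rewrite mulr_suml gr_coef_sum; apply: eq_bigr => j _; rewrite gr_coef_eltM.
Qed.

End GroupRingTrace.

Section MatrixTrace.

Variables (F : comNzRingType) (p : nat) (G : groupType).
Implicit Types a b : group_ring 'M[F]_p.+1 G.

Definition gr_mxtrace a : F := \tr (a@_1%g).

Lemma gr_mxtraceD : {morph gr_mxtrace : a b / a + b}.
Proof. by move=> a b; rewrite /gr_mxtrace gr_coefD linearD. Qed.

Lemma gr_mxtrace0 : gr_mxtrace 0 = 0.
Proof. by rewrite /gr_mxtrace mcoeff0 linear0. Qed.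

Lemma gr_mxtrace_sum (I : Type) (l : seq I) (f : I -> group_ring 'M[F]_p.+1 G) :
  gr_mxtrace (\sum_(i <- l) f i) = \sum_(i <- l) gr_mxtrace (f i).
Proof. exact: (big_morph gr_mxtrace gr_mxtraceD gr_mxtrace0). Qed.

(** In a group [x y = 1] exactly when [y x = 1], and the trace of matrices is cyclic. *)
Lemma gr_mxtraceC a b : gr_mxtrace (a * b) = gr_mxtrace (b * a).
Proof.
have E c d : gr_mxtrace (c * d) = \sum_(x <- msupp c) \sum_(y <- msupp d)
    gr_mxtrace (gr_elt (c@_x) x * gr_elt (d@_y) y).
  rewrite {1}(gr_sum c) mulr_suml gr_mxtrace_sum; apply: eq_bigr => x _.
  by rewrite {1}(gr_sum d) mulr_sumr gr_mxtrace_sum.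
rewrite E [RHS]E exchange_big; apply: eq_bigr => x _; apply: eq_bigr => y _.
rewrite !gr_eltM /gr_mxtrace !gr_coef_elt.
have -> : (y * x == 1)%g = (x * y == 1)%g.
  by apply/eqP/eqP => /mulg1_eq <-; rewrite ?mulgV ?mulVg.
by case: eqP => _; rewrite ?linear0 // mulr1n; apply: mxtrace_mulC.
Qed.

End MatrixTrace.

(** [c] is one full turn that starts at the root [p] and returns to it, so turns compose. The
    projection [e] can replace [p] because both select the same first steps. *)
Lemma corner_power (E : nzRingType) (e p b c : E) (l k : nat) : (0 < l)%N ->
  e * b = p * b -> p * b ^+ l = c -> c * p = c -> e * b ^+ (k.+1 * l) = c ^+ k.+1.
Proof.
move=> l0 epb pbc cp; elim: k => [|k IHk].
  by rewrite mul1n expr1 -pbc -(prednK l0) exprS !mulrA epb.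
have cXp : c ^+ k.+1 * p = c ^+ k.+1 by rewrite exprSr -mulrA cp.
by rewrite mulSn addnC exprD mulrA IHk -cXp -mulrA pbc -exprSr.
Qed.

(** * The cyclic automaton reading the words of the element *)

Section Automaton.

Variables (F : numFieldType) (n r l : nat).
Variables (c : 'I_r -> F) (g : 'I_r -> free_group n).
Hypothesis l0 : (0 < l)%N.
Hypothesis size_g : forall j, (size (word_of (g j)) <= l)%N.

Local Notation M := ('M[F]_((r * l).+1)).
Local Notation E := (group_ring M (free_group n)).
Local Notation El x y := (delta_mx x y : M).

Let a : group_ring F (free_group n) := \sum_j gr_elt (c j) (g j).

(* State i of the cycle reading the word g j; all the cycles share state 0. *)
Definition state (j : 'I_r) (i : nat) : 'I_(r * l).+1 :=
  inord (if l %| i then 0 else j * l + i)%N.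

Lemma state_val (j : 'I_r) (i : nat) : (i <= l)%N ->
  state j i = (if l %| i then 0 else j * l + i)%N :> nat.
Proof.
move=> le_il; rewrite inordK // ltnS; case: ifP => // li.
by have := ltn_ord j; rewrite -(leq_pmul2r l0); lia.
Qed.

Lemma state_mod j i : (i <= l)%N -> (state j i %% l = i %% l)%N.
Proof.
move=> le_il; rewrite state_val //; case: ifP => [/eqP ->|_].
  by rewrite mod0n.
by rewrite modnMDl.
Qed.

Lemma dvdn_lt i : (i < l)%N -> (l %| i)%N = (i == 0)%N.
Proof. by move=> lt_il; rewrite /dvdn modn_small. Qed.

Lemma state0 j i : (i < l)%N -> (0 == state j i) = (i == 0)%N.
Proof.
move=> lt_il; rewrite -val_eqE /= state_val ?(ltnW lt_il) // dvdn_lt //.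
by case: (i == 0)%N / eqP => [//|i0]; apply/negbTE; lia.
Qed.

Lemma state_l j : state j l = 0.
Proof. by apply: val_inj; rewrite /= state_val // dvdnn. Qed.

Lemma state_inj j i j1 i1 : (0 < i < l)%N -> (i1 < l)%N ->
  (state j i == state j1 i1) = (j == j1) && (i == i1).
Proof.
case/andP=> i0 lt_il lt_i1l; apply/eqP/andP => [Es|[/eqP -> /eqP ->]] //.
have Ei : i = i1.
  have := state_mod j (ltnW lt_il); rewrite Es state_mod ?(ltnW lt_i1l) //.
  by rewrite !modn_small.
rewrite -Ei in Es *; split=> //.
have := congr1 val Es; rewrite /= !state_val ?(ltnW lt_il) // dvdn_lt //.
by rewrite (gtn_eqF i0) => /addIn /eqP; rewrite eqn_pmul2r.
Qed.

(** The coefficient [c j] is carried by the first edge of its cycle, so that each full turn picks it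
    up once. *)
Definition automaton : E := \sum_(u : 'I_r * 'I_l)
  gr_elt ((if u.2 == 0 :> nat then c u.1 else 1) *: El (state u.1 u.2) (state u.1 u.2.+1))
    (fg_segment u.2 (g u.1)).

(** Selects the states at position [i] of their cycle, since the state numbered [j * l + i] is
    congruent to [i] modulo [l]. *)
Definition grade (i : nat) : M := diag_mx (\row_x (x %% l == i %% l)%N%:R).

Lemma grade_mull i x y : grade i * El x y = El x y *+ (x %% l == i %% l)%N.
Proof.
apply/matrixP => z w; rewrite -[grade i * _]/(grade i *m _) mul_diag_mx mulmxnE !mxE.
have [->|_] := eqVneq z x; last by rewrite mulr0 mul0rn.
by case: (w == y); case: (_ == _)%N; rewrite ?mulr1 ?mul1r ?mulr0 ?mul0rn.
Qed.

Lemma grade_mulr i x y : El x y * grade i = El x y *+ (y %% l == i %% l)%N.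
Proof.
apply/matrixP => z w; rewrite -[_ * grade i]/(_ *m grade i) mul_mx_diag mulmxnE !mxE.
have [->|_] := eqVneq w y; last by rewrite andbF mul0r mul0rn.
by case: (z == x); case: (_ == _)%N; rewrite ?mulr1 ?mul1r ?mulr0 ?mul0r ?mul0rn.
Qed.

Lemma gradeM i j : grade i * grade j = if (i == j %[mod l])%N then grade i else 0.
Proof.
apply/matrixP => z w; rewrite -[grade i * _]/(grade i *m _) mul_diag_mx !mxE.
case: (i %% l =P j %% l)%N => [Eij|ij].
  by rewrite !mxE Eij; case: (_ == _)%N; rewrite ?mul1r ?mul0r ?mul0rn.
rewrite !mxE; case: (z == w); last by rewrite mulr0.
rewrite mulr1n; case: (z %% l =P i %% l)%N => [->|_]; last by rewrite mul0r.
by case: (i %% l =P j %% l)%N ij => // _ _; rewrite mulr0.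
Qed.

Lemma sum_grade : \sum_(i < l) grade i = 1.
Proof.
apply/matrixP => z w; rewrite summxE mxE.
rewrite (bigD1 (Ordinal (ltn_pmod z l0))) //= big1 ?addr0 => [|i ne].
  by rewrite !mxE modn_mod eqxx.
rewrite !mxE; case: eqP => [zi|_]; last by rewrite mul0rn.
by case/eqP: ne; apply: val_inj; rewrite /= zi modn_small.
Qed.

Lemma El_mul x y z w : El x y * El z w = El x w *+ (y == z).
Proof. exact: mul_delta_mx_cond. Qed.

Definition gr_grade (i : nat) : E := gr_elt (grade i) 1%g.

Lemma gr_grade_shift i : gr_grade i * automaton = automaton * gr_grade i.+1.
Proof.
rewrite /automaton mulr_sumr mulr_suml; apply: eq_bigr => -[j k] _ /=.
rewrite /gr_grade !gr_eltM mul1g mulg1 -scalerAr -scalerAl grade_mull grade_mulr.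
rewrite (state_mod j (ltnW (ltn_ord k))) (state_mod j (ltn_ord k)).
by rewrite -[k.+1]addn1 -[i.+1]addn1 eqn_modDr.
Qed.

Definition gr_root : E := gr_elt (El 0 0) 1%g.

(** The indices that are nonzero multiples of [l] also have grade 0, but no transition leaves
    them. *)
Lemma gr_grade0 : gr_grade 0 * automaton = gr_root * automaton.
Proof.
apply: etrans (mulr_sumr _ _ _ _) _; apply: etrans _ (esym (mulr_sumr _ _ _ _)).
apply: eq_bigr => -[j k] _ /=.
rewrite [LHS]gr_eltM [RHS]gr_eltM -scalerAr -[in RHS]scalerAr grade_mull El_mul.
rewrite (state_mod j (ltnW (ltn_ord k))) mod0n.
rewrite (modn_small (ltn_ord k)) (state0 j (ltn_ord k)).
case: eqP => [k0|_]; last by rewrite !mulr0n.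
suff -> : state j k = 0 by [].
by apply/eqP; rewrite eq_sym (state0 j (ltn_ord k)) k0.
Qed.

(** The first step from the root chooses [j]; no other cycle passes through the inner states of
    cycle [j], so the walk is then forced to read [g j]. *)
Lemma automaton_walk m : (0 < m <= l)%N ->
  gr_root * automaton ^+ m =
  \sum_j gr_elt (c j *: El 0 (state j m)) (fg_prefix m (g j)).
Proof.
elim: m => // m IHm /= lt_ml; rewrite exprSr mulrA.
have pairE (f : 'I_r * 'I_l -> E) : \sum_u f u = \sum_j \sum_i f (j, i).
  by rewrite pair_big; apply: eq_bigr => -[].
have [m0|m_gt0] := posnP m.
  rewrite m0 expr0 mulr1 /automaton mulr_sumr pairE; apply: eq_bigr => j _.
  rewrite (bigD1 (Ordinal l0)) //= big1 ?addr0 => [|i ne].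
    by rewrite /gr_root gr_eltM -scalerAr El_mul (state0 j l0) fg_prefixS fg_prefix0.
  rewrite /gr_root gr_eltM -scalerAr El_mul (state0 j (ltn_ord i)).
  have -> : (i == 0 :> nat) = false by apply: contraNF ne => /eqP i0; apply/eqP/val_inj.
  by rewrite scaler0 gr_elt0.
rewrite IHm; last by rewrite m_gt0 ltnW.
rewrite mulr_suml; apply: eq_bigr => j _.
rewrite /automaton mulr_sumr (bigD1 (j, Ordinal lt_ml)) //= big1 ?addr0 => [|[j1 i1] ne].
  rewrite gr_eltM -scalerAl -scalerAr El_mul eqxx fg_prefixS.
  by rewrite (gtn_eqF m_gt0) scale1r.
rewrite gr_eltM -scalerAl -scalerAr El_mul.
rewrite (state_inj j j1 _ (ltn_ord i1)); last by rewrite m_gt0.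
have -> : (j == j1) && (m == i1) = false.
  apply: contraNF ne => /andP[/eqP -> /eqP mi]; apply/eqP; congr (_, _).
  by apply: val_inj.
by rewrite !scaler0 gr_elt0.
Qed.

Definition gr_corner : E := \sum_j gr_elt (c j *: El 0 0) (g j).

Lemma automaton_cycle : gr_root * automaton ^+ l = gr_corner.
Proof.
rewrite automaton_walk; last by rewrite l0 leqnn.
apply: eq_bigr => j _.
by rewrite state_l fg_prefix_size.
Qed.

Lemma gr_corner_root : gr_corner * gr_root = gr_corner.
Proof.
rewrite /gr_corner mulr_suml; apply: eq_bigr => j _.
by rewrite /gr_root gr_eltM mulg1 -scalerAl El_mul eqxx.
Qed.

Lemma automaton_cycles k :
  gr_grade 0 * automaton ^+ (k.+1 * l) = gr_corner ^+ k.+1.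
Proof. exact: (corner_power k l0 gr_grade0 automaton_cycle gr_corner_root). Qed.

(** [gr_corner] is [a] with its coefficients multiplied by the matrix unit [El 0 0], which is
    idempotent, so positive powers correspond. *)
Lemma gr_corner_coef k x : (gr_corner ^+ k.+1)@_x = (a ^+ k.+1)@_x *: El 0 0.
Proof.
elim: k x => [|k IHk] x.
  rewrite -[gr_corner ^+ 1]/gr_corner -[a ^+ 1]/a /gr_corner /a.
  rewrite 2!gr_sum_coef scaler_suml.
  by apply: eq_bigr => j _; case: (_ == _); rewrite ?scale0r.
rewrite exprS [in RHS]exprS; apply: etrans (gr_sum_coefM _ _ _ _ _) _.
apply: etrans _ (congr1 (fun z => z *: _) (esym (gr_sum_coefM _ _ _ _ _))).
rewrite scaler_suml; apply: eq_bigr => j _; rewrite IHk.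
by rewrite -scalerAl -scalerAr El_mul eqxx scalerA.
Qed.

Lemma automaton_trace m :
  gr_mxtrace (automaton ^+ m.+1) =
  if (l %| m.+1)%N then (gr_trace (a ^+ (m.+1 %/ l))) *+ l else 0.
Proof.
have sum1 : \sum_(i < l) gr_grade i = 1.
  by rewrite /gr_grade -gr_elt_sum sum_grade.
have idem i : gr_grade i * gr_grade i = gr_grade i.
  apply: etrans (gr_eltM _ _ _ _) _.
  rewrite mulg1 gradeM eqxx; reflexivity.
have orth i j : i != j %[mod l] -> gr_grade i * gr_grade j = 0.
  move=> /negbTE ij; apply: etrans (gr_eltM _ _ _ _) _.
  by rewrite mulg1 gradeM ij; apply: gr_elt0.
have := (cyclic_trace (@gr_mxtraceD _ _ _) (@gr_mxtrace0 _ _ _)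
  (@gr_mxtraceC _ _ _) sum1 idem orth gr_grade_shift m).
move=> ct; apply: etrans ct _.
case: ifP => // /dvdnP[[|k] Ek]; first by rewrite mul0n in Ek.
rewrite Ek mulnK // automaton_cycles /gr_mxtrace gr_corner_coef linearZ /=.
rewrite /mxtrace (bigD1 0) //= big1 ?addr0 => [|i i0].
  by rewrite mxE !eqxx mulr1.
by rewrite mxE (negbTE i0).
Qed.

Lemma automaton_linear : exists b0 b, automaton = gr_linear b0 b.
Proof.
apply: gr_linear_sum => u /=; rewrite size_take_min.
exact: geq_minl.
Qed.

End Automaton.

Theorem gr_linearization (F : numFieldType) (n : nat) (a : group_ring F (free_group n)) :
  exists l p (b0 : 'M[F]_p.+1) (b : letter n -> 'M[F]_p.+1), forall m,
    gr_mxtrace (gr_linear b0 b ^+ m.+1) =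
    if (l.+1 %| m.+1)%N then (gr_trace (a ^+ (m.+1 %/ l.+1))) *+ l.+1 else 0.
Proof.
pose r := size (msupp a); pose g (j : 'I_r) := nth 1%g (msupp a) j.
pose c j := a@_(g j); pose l := \max_j size (word_of (g j)).
have Ea : a = \sum_j gr_elt (c j) (g j).
  by rewrite [LHS]gr_sum (big_nth 1%g) big_mkord.
(* The successor makes the common length positive even when the maximum is 0. *)
have size_g j : (size (word_of (g j)) <= l.+1)%N.
  by apply/leqW; apply: (leq_bigmax j).
have [b0 [b E]] := automaton_linear l.+1 c g.
exists l, (r * l.+1)%N.
exists b0, b => m; rewrite -E Ea.
exact: automaton_trace.
Qed.

(** * Substitution of a power of the variable *)

Section Substitution.

Variables (R : comNzRingType) (l : nat).
Implicit Types f g : fps R.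

(** The series f(t^(l+1)). *)
Definition fps_subst f : fps R :=
  FPS (fun m => if (l.+1 %| m)%N then fps_coef f (m %/ l.+1) else 0).

Lemma fps_coef_subst f m : fps_coef (fps_subst f) m =
  if (l.+1 %| m)%N then fps_coef f (m %/ l.+1) else 0.
Proof. by []. Qed.

Fact fps_subst_is_zmod_morphism : zmod_morphism fps_subst.
Proof.
by move=> f g; apply: fpsP => m /=; case: ifP => // _; rewrite subr0.
Qed.

Fact fps_subst_is_monoid_morphism : monoid_morphism fps_subst.
Proof.
split=> [|f g]; apply: fpsP => m.
  rewrite /= ; case: ifP => [lm|lm]; last by case: m lm => //; rewrite dvdn0.
  by rewrite -{2}(divnK lm) muln_eq0 orbF.
(* Truncation reduces multiplicativity to that of composing polynomials with X^(l+1). *)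
pose tr (h : fps R) := fps_trunc m h.
have trE (h : fps R) i : (i <= m)%N -> ((tr h) \Po 'X^(l.+1))`_i = fps_coef (fps_subst h) i.
  move=> le_im; rewrite coef_comp_poly_Xn //=; case: ifP => // _.
  by rewrite fps_truncE // (leq_trans (leq_div _ _)).
rewrite [RHS]fps_coefM; transitivity ((tr f * tr g) \Po 'X^(l.+1))`_m.
  rewrite coef_comp_poly_Xn //=; case: ifP => // _.
  by rewrite -fps_mul_trunc ?leq_div.
rewrite comp_polyM coefM; apply: eq_bigr => i _.
by rewrite !trE ?leq_subr // -ltnS.
Qed.

HB.instance Definition _ :=
  GRing.isZmodMorphism.Build (fps R) (fps R) fps_subst fps_subst_is_zmod_morphism.
HB.instance Definition _ :=
  GRing.isMonoidMorphism.Build (fps R) (fps R) fps_subst fps_subst_is_monoid_morphism.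

Lemma fps_subst_inj : injective fps_subst.
Proof.
move=> f g fg; apply: fpsP => k.
have := congr1 (fun h => fps_coef h (k * l.+1)%N) fg.
by rewrite /= dvdn_mull // mulnK.
Qed.

Lemma fps_substC c : fps_subst (fpsC c) = fpsC c.
Proof.
apply: fpsP => m /=; rewrite !coefC; case: ifP => [lm|].
  by rewrite -{2}(divnK lm) muln_eq0 orbF.
by case: m.
Qed.

Lemma fps_substX : fps_subst (fpsX R) = fpsX R ^+ l.+1.
Proof.
rewrite -rmorphXn; apply: fpsP => m /=; rewrite coefX coefXn; case: ifP => [lm|lm].
  have -> : (m == l.+1) = (m %/ l.+1 * l.+1 == 1 * l.+1)%N by rewrite divnK ?mul1n.
  by rewrite eqn_pmul2r.
by case: eqP lm => // ->; rewrite dvdnn.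
Qed.

End Substitution.

Lemma fps_subst_exp (F : numFieldType) (l : nat) (f : fps F) :
  fps_coef f 0 = 0 -> fps_subst l (fps_exp f) = fps_exp (fps_subst l f).
Proof.
move=> f0; apply: fpsP => m.
have sf0 : fps_coef (fps_subst l f) 0 = 0 by rewrite /= div0n.
rewrite (fps_coef_exp sf0 (ltnSn m)).
rewrite (eq_bigr (fun k : 'I_m.+1 => fps_coef (fps_subst l (f ^+ k)) m / k`!%:R)).
  rewrite fps_coef_subst; case: ifP => lm.
    rewrite (fps_coef_exp (N := m.+1) f0) ?ltnS ?leq_div //.
    by apply: eq_bigr => k _; rewrite fps_coef_subst lm.
  by rewrite big1 // => k _; rewrite fps_coef_subst lm mul0r.
by move=> k _; rewrite rmorphXn.
Qed.

Theorem fps_exp_trace_algebraic (F : numFieldType) (n : nat)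
    (a : group_ring F (free_group n)) :
  fps_algebraic (fps_exp (- trace_series a)).
Proof.
have [l [p [b0 [b trb]]]] := gr_linearization a.
set P := fps_exp _.
(* The substitution is part of the embedding, so that a relation for P(t^(l+1)) over its image is
   the substitute of a relation for [P] itself. *)
pose phi : {rmorphism {poly F} -> {fraction fps F}} :=
  (@tofrac (fps F) \o fps_subst l \o @fps_of_poly F)%FUN.
have EP : fps_subst l P = fps_exp (- mx_trace_series (gr_linear b0 b)).
  have tr0 : fps_coef (- trace_series a) 0 = 0 by rewrite /= oppr0.
  rewrite (fps_subst_exp l tr0) rmorphN; congr (fps_exp (- _)).
  apply: fpsP => -[|m]; first by rewrite fps_coef_subst dvdn0 div0n.
  rewrite fps_coef_subst [RHS]/= -[\tr _]/(gr_mxtrace _) trb /=.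
  case: ifP => [/dvdnP[k Ek]|]; last by rewrite mul0r.
  rewrite Ek mulnK //; case: k Ek => [|k _] //.
  (* The factor [l.+1] of the trace cancels against the one in the exponent. *)
  by rewrite -[_ *+ l.+1]mulr_natr natrM -mulf_div divff ?mulr1 ?pnatr_eq0.
have [d dder dphi|Q Q0 rootQ] := @algebraic_of_derivations _
    (fraction_fps_natr_neq0 F) _ phi (tofrac (fps_subst l P)).
  rewrite EP; apply: derivation_linear_det => // [c|].
    by have := dphi c%:P; rewrite /phi /= -[fps_of_poly _]/(fpsC c) fps_substC.
  (* [d] kills t^(l+1), whose derivative is (l+1) t^l dt; characteristic 0 gives dt = 0. *)
  have := dphi 'X; rewrite /phi /= -[fps_of_poly _]/(fpsX F) fps_substX rmorphXn.
  rewrite (derivationX dder) => /eqP; rewrite !mulf_eq0.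
  rewrite (negbTE (fraction_fps_natr_neq0 _ _)) expf_eq0 tofrac_eq0 /=.
  have -> : (fpsX F == 0) = false.
    by apply/eqP => /(congr1 (fun f => fps_coef f 1))/eqP; rewrite /= coefX oner_eq0.
  by rewrite andbF => /eqP.
exists Q => //.
have := rootQ; rewrite /root map_poly_comp map_poly_comp !horner_map /= tofrac_eq0.
by move=> /eqP E; apply/eqP/(@fps_subst_inj F l); rewrite E rmorph0.
Qed.

Theorem theorem1 (R : realType) (n : nat) (n_ge1 : (1 <= n)%N)
    (a : group_ring R[i] (free_group n)) :
  fps_algebraic (fps_exp (- trace_series a)).
Proof. exact: fps_exp_trace_algebraic. Qed.
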